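(* For every integer $r \ge 2$ and every real $\epsilon$ with $0 < \epsilon \leq \frac{1}{r}-\frac{1}{r^3}$ there exists $n_0 = n_0(r,\epsilon)$ such that for every integer $n>n_0$, $$ b_n(r,1/r-\epsilon) \ge \frac{\log n}{6000\,\epsilon\, r \log r }\;. $$
   Context: Graphs are finite and simple. For positive integers $k,b$, $K_{k}(b)$ (the $b$-blow-up of the complete graph $K_k$) is the graph consisting of $k$ disjoint vertex sets $V_1,\ldots,V_{k}$ of size $b$ each, where for every $i \neq j$ every vertex of $V_i$ is adjacent to every vertex of $V_j$. For an integer $r\ge 2$ and real $0<\delta<1/r$, $b_n(r,\delta)$ denotes the largest integer $b$ such that every $n$-vertex graph with at least $(1-1/r+\delta)n^2/2$ edges contains a copy of $K_{r+1}(b)$ as a (not necessarily induced) subgraph. In particular, $b_n(r,1/r-\epsilon)$ concerns $n$-vertex graphs with at least $(1-\epsilon)n^2/2$ edges. Floor and ceiling signs are omitted, since they are immaterial for the asymptotic estimates. *)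

(* Defs.v *)
From mathcomp Require Import all_boot all_order all_algebra.
From mathcomp Require Import reals exp.

Set Implicit Arguments.
Unset Strict Implicit.
Unset Printing Implicit Defensive.

Import Order.TTheory GRing.Theory Num.Theory.
Local Open Scope ring_scope.

Record simple_graph (T : finType) := SimpleGraph {
  adj :> rel T;
  adj_sym : symmetric adj;
  adj_irr : irreflexive adj
}.

Definition edges (T : finType) (G : simple_graph T) : {set {set T}} :=
  [set [set p.1; p.2] | p : T * T & G p.1 p.2].

Section Blowup.
Variables k b : nat.

(* The vertex (i, u) is the u-th vertex of the part V_i. *)
Definition blowup_adj : rel ('I_k * 'I_b)%type :=
  fun x y => x.1 != y.1.

Lemma blowup_adj_sym : symmetric blowup_adj.
Proof. by move=> x y; rewrite /blowup_adj eq_sym. Qed.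

Lemma blowup_adj_irr : irreflexive blowup_adj.
Proof. by move=> x; rewrite /blowup_adj eqxx. Qed.

Definition complete_blowup : simple_graph ('I_k * 'I_b)%type :=
  SimpleGraph blowup_adj_sym blowup_adj_irr.

End Blowup.

Definition contains_copy (S T : finType)
    (H : simple_graph S) (G : simple_graph T) : Prop :=
  exists2 f : S -> T, injective f & forall x y, H x y -> G (f x) (f y).

Definition forces_blowup (R : realType) (n r : nat) (delta : R) (b : nat) :
    Prop :=
  forall (T : finType) (G : simple_graph T), #|T| = n ->
    (1 - r%:R^-1 + delta) * n%:R ^+ 2 / 2 <= #|edges G|%:R ->
    contains_copy (complete_blowup r.+1 b) G.

(* "b = b_n(r, delta)", as a relation because the maximum does not exist when
   no n-vertex graph has the required number of edges. The value b = 0 is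
   allowed, and every graph contains the empty graph K_{r+1}(0). *)
Definition is_bn (R : realType) (n r : nat) (delta : R) (b : nat) : Prop :=
  forces_blowup n r delta b /\
  forall b' : nat, forces_blowup n r delta b' -> (b' <= b)%N.

(* Main.v *)
Require Import Defs.
From mathcomp Require Import all_boot all_order all_algebra.
From mathcomp Require Import reals exp.
From mathcomp Require boolp sequences.
From mathcomp Require Import zify ring lra.

Import Order.TTheory GRing.Theory Num.Theory.
Local Open Scope ring_scope.

Set Implicit Arguments.
Unset Strict Implicit.
Unset Printing Implicit Defensive.

Local Notation expR := sequences.expR.

(** The proof grows a complete multipartite subgraph, recorded as the list of
    its parts.  The basic step is a random deletion: if many vertices each
    miss at most y vertices of the current structure, then after the deletion
    of slightly more than y vertices of it, at least a fraction q^-y of these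
    many vertices is joined to everything that remains, where ln q is of the
    order of ln r ([many_common_removed]).  As long as q^y is well below n,
    this leaves enough vertices to form a new part of size B.

    First pass to a subset of linear size in which every vertex has few
    non-neighbours ([exists_dense_subset]), say at most eps n.  A structure
    with M vertices is then missed in at most eps M vertices on average, so a
    step gains B vertices and loses about eps M: the structure grows until M is
    about B / eps, provided that B is a small multiple of ln n / (eps r ln r)
    and M stays of order r B.  Unions of parts are again completely joined, so once
    M exceeds r B + b, where b = B / 320, the parts can be grouped into r + 1
    sets of size at least b ([blowup_of_mass]).  This settles the case
    eps r <= 9 / 10 ([blowup_of_few_missing]).

    When eps is close to 1 / r the growth may stop with M just below r B.
    Then a structure of maximal size consists of r parts of almost full size
    and a negligible rest, and all but a proportion of order 1 / r of the
    vertices miss one part almost entirely ([free_structure], [few_extending]).  This sorts the vertices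
    into r classes.  If many vertices of a class have a positive proportion of
    the class as neighbours, two new parts can be found inside the class and
    joined to the r - 1 parts of the other classes ([few_heavy]).  Otherwise
    the classes are nearly independent, and since degrees are bounded below,
    they have almost equal sizes and almost all pairs across them are edges:
    for one vertex taken from each class, the proportions of the other classes
    missed by these r vertices add up to at most 1 / 24, whatever r is.

    It remains to treat this near-Turan situation ([blowup_of_near_turan]).
    Assign each vertex of the graph to the class of which it misses the
    largest proportion.  One of the r sets so obtained has at least n / r
    vertices, and a vertex has fewer than n / r non-neighbours, so every
    vertex of the corresponding class has neighbours in this set.  They yield
    a part Y inside the class, completely joined to a part Z of vertices
    closest to the class ([dense_pair]).  Parts from the other r - 1 classes
    are then attached one at a time ([embed_classes]).  The vertices of the
    classes miss so little in total that no part taken from a class loses more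
    than a fixed proportion.  The vertices of Z may miss about half of several
    classes, and Z is kept large by an exponential weight ([boost]). *)

(** * Counting *)

Section Counting.
Local Open Scope nat_scope.

Lemma ffact_le_exp m k : m ^_ k <= m ^ k.
Proof.
rewrite ffact_prod -[k in m ^ k]card_ord -prod_nat_const.
by apply: leq_prod => i _; apply: leq_subr.
Qed.

Lemma exp_le_ffact g k : k <= g -> (g - k) ^ k <= g ^_ k.
Proof.
move=> le_kg; rewrite ffact_prod -[k in _ ^ k]card_ord -prod_nat_const.
by apply: leq_prod => i _; apply: leq_sub2l; apply: ltnW.
Qed.

(** A random k-subset of an m-set lies in a given g-subset with
    probability at least q^-k.  This is the better estimate when the subset to
    be kept is small compared with the set it is chosen from. *)
Lemma bin_kept_ratio m g k q :
  0 < k -> 2 * k <= g -> m <= q * k -> 'C(m, k) <= 'C(g, k) * q ^ k.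
Proof.
move=> k0 le_kg le_mq.
have: 'C(m, k) * k`! <= ('C(g, k) * q ^ k) * k`!.
  rewrite mulnAC !bin_ffact; apply: leq_trans (ffact_le_exp _ _) _.
  apply: leq_trans (leq_mul (exp_le_ffact (_ : k <= g)) (leqnn _)); last by lia.
  rewrite -expnMn leq_exp2r //; apply: leq_trans le_mq _; rewrite mulnC.
  by rewrite leq_mul2r; apply/orP; right; lia.
by rewrite leq_pmul2r ?fact_gt0.
Qed.

(** A random k-subset of an m-set avoids y given elements with
    probability at least q^-y.  Only the number of elements to avoid enters the
    exponent; the slack w between k and m - y makes each of them cost at most a
    factor m / w. *)
Lemma bin_removed_ratio m y w k q :
  m <= q * w -> k + w + y <= m -> 0 < w -> 'C(m, k) <= 'C(m - y, k) * q ^ y.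
Proof.
elim: y m => [|y IHy] m le_mq le_km w0; first by rewrite subn0 expn0 muln1.
case: m le_mq le_km => [|m] le_mq le_km; first by lia.
have IH : 'C(m, k) <= 'C(m - y, k) * q ^ y by apply: IHy => //; lia.
have E := mul_bin_down m.+1 k; rewrite /= in E.
rewrite subSS expnS mulnCA.
apply: leq_trans (leq_mul (leqnn q) IH).
rewrite -(leq_pmul2l w0).
apply: (@leq_trans ((m.+1 - k) * 'C(m.+1, k))).
  by rewrite leq_mul2r; apply/orP; right; lia.
by rewrite -E mulnCA mulnA; apply: leq_mul.
Qed.

Lemma exists_le_sum (I : finType) (A : {set I}) (f : I -> nat) (n : nat) :
  A != set0 -> n * #|A| <= \sum_(i in A) f i -> exists2 i, i \in A & n <= f i.
Proof.
case/set0Pn => i0 Ai0 le_n.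
case: (boolP [exists i in A, n <= f i]) => [/existsP[i /andP[Ai le]]|]; first by exists i.
rewrite negb_exists => /forallP H; exfalso.
suff: \sum_(i in A) f i < n * #|A| by rewrite ltnNge le_n.
rewrite mulnC -sum_nat_const (bigD1 i0) //= [X in _ < X](bigD1 i0) //=.
have F i : i \in A -> f i < n by move=> Ai; move: (H i); rewrite Ai /= -ltnNge.
rewrite -addSn leq_add ?F //; apply: leq_sum => i /andP[Ai _]; exact/ltnW/F.
Qed.

Lemma sum_card_exchange (I J : finType) (A : {set I}) (B : {set J}) (r : I -> J -> bool) :
  \sum_(i in A) #|[set j in B | r i j]| = \sum_(j in B) #|[set i in A | r i j]|.
Proof.
have E1 (K : finType) (D : {set K}) (P : pred K) :
    #|[set k in D | P k]| = \sum_(k in D) P k.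
  by rewrite -sum1dep_card big_mkcondr.
under eq_bigr do rewrite E1.
by rewrite exchange_big /=; apply: eq_bigr => j _; rewrite E1.
Qed.

Lemma leq_card_bigcup (I T : finType) (A : I -> {set T}) :
  #|\bigcup_i A i| <= \sum_i #|A i|.
Proof.
elim/big_rec2: _ => [|i m X _ le]; first by rewrite cards0.
by apply: leq_trans (leq_card_setU _ _) _; rewrite leq_add2l.
Qed.

(** Choice of a maximum for an undecidable property, used for the
    largest multipartite structure and for the extremal function itself. *)
Lemma ex_max_nat (P : nat -> Prop) N : (exists m, P m) ->
  (forall m, P m -> m <= N) -> exists m, P m /\ forall m', P m' -> m' <= m.
Proof.
move=> exP leN; pose p m := boolp.asbool (P m).
have exp : exists m, p m by case: exP => m Pm; exists m; apply/boolp.asboolP.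
have lep m : p m -> m <= N by move/boolp.asboolP/leN.
case: (ex_maxnP exp lep) => m /boolp.asboolP Pm maxm.
by exists m; split=> // m' Pm'; apply/maxm/boolp.asboolP.
Qed.

End Counting.

(** * Non-neighbours, complete pairs and random deletion *)

Section Graph.
Variables (T : finType) (G : simple_graph T).
Local Open Scope nat_scope.
Implicit Types (A B C K P S V W X Y Z : {set T}) (s : seq {set T}).

(** A vertex of A counts among its own non-neighbours in A. *)
Definition nadj A v := #|[set u in A | ~~ G v u]|.
Definition nbr A v := #|[set u in A | G v u]|.

Lemma nbrD A v : nbr A v + nadj A v = #|A|.
Proof.
rewrite -(cardsID [set u | G v u] A); congr (_ + _); apply: eq_card => u;
  by rewrite !inE // andbC.
Qed.

Lemma sum_nadj A B : \sum_(v in A) nadj B v = \sum_(u in B) nadj A u.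
Proof.
rewrite sum_card_exchange; apply: eq_bigr => u _; apply: eq_card => v.
by rewrite !inE adj_sym.
Qed.

Lemma sum_nbr A B : \sum_(v in A) nbr B v = \sum_(u in B) nbr A u.
Proof.
rewrite sum_card_exchange; apply: eq_bigr => u _; apply: eq_card => v.
by rewrite !inE adj_sym.
Qed.

Lemma nadj_sub A B v : A \subset B -> nadj A v <= nadj B v.
Proof.
move=> sAB; apply: subset_leq_card; apply/subsetP => u; rewrite !inE.
by case/andP => /(subsetP sAB) -> ->.
Qed.

Lemma nbr_sub A B v : A \subset B -> nbr A v <= nbr B v.
Proof.
move=> sAB; apply: subset_leq_card; apply/subsetP => u; rewrite !inE.
by case/andP => /(subsetP sAB) -> ->.
Qed.

Lemma nadjU A B v : [disjoint A & B] -> nadj (A :|: B) v = nadj A v + nadj B v.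
Proof.
move=> dAB; rewrite /nadj -cardsUI.
have -> : [set u in A :|: B | ~~ G v u]
   = [set u in A | ~~ G v u] :|: [set u in B | ~~ G v u].
  by apply/setP => u; rewrite !inE andb_orl.
rewrite -[LHS]addn0; congr (_ + _); apply/esym/eqP; rewrite cards_eq0.
apply/eqP/setP => u; rewrite !inE; case uA: (u \in A) => //=.
by rewrite (disjointFr dAB uA) andbF.
Qed.

Definition complete A B := [forall x in A, forall y in B, G x y].

Lemma completeP A B :
  reflect (forall x y, x \in A -> y \in B -> G x y) (complete A B).
Proof.
apply: (iffP forall_inP) => [H x y xA yB | H x xA].
  by move/forall_inP: (H x xA); apply.
by apply/forall_inP => y; apply: H.
Qed.

Lemma complete_sym : symmetric complete.
Proof.
by move=> A B; apply/completeP/completeP => H x y xA yB; rewrite adj_sym; apply: H.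
Qed.

Lemma completeS A B A' B' :
  A' \subset A -> B' \subset B -> complete A B -> complete A' B'.
Proof.
move=> sA sB /completeP H; apply/completeP => x y xA yB.
by apply: H; [apply: (subsetP sA) | apply: (subsetP sB)].
Qed.

Lemma complete_disjoint A B : complete A B -> [disjoint A & B].
Proof.
move/completeP => H; rewrite disjoint_subset; apply/subsetP => x xA.
by rewrite !inE; apply/negP => xB; have := H x x xA xB; rewrite adj_irr.
Qed.

Lemma completeUl A B C : complete (A :|: B) C = complete A C && complete B C.
Proof.
apply/completeP/andP => [H|[/completeP HA /completeP HB] x y].
  by split; apply/completeP => x y xA yC; apply: H => //; rewrite inE xA ?orbT.
by rewrite inE => /orP[]; [apply: HA | apply: HB].
Qed.

(** Some k-subset of S has at least the average number of common
    neighbours in V. *)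
Lemma many_common_subset S V k g :
  k <= #|S| -> (forall v, v \in V -> g <= nbr S v) ->
  exists K W, [/\ K \subset S, #|K| = k, W = [set v in V | complete [set v] K]
     & #|V| * 'C(g, k) <= #|W| * 'C(#|S|, k)].
Proof.
move=> le_kS degV.
pose D := [set K : {set T} | K \subset S & #|K| == k].
have cD : #|D| = 'C(#|S|, k) by rewrite -cards_draws.
pose r (K : {set T}) v := complete [set v] K.
have sumE : #|V| * 'C(g, k) <= \sum_(K in D) #|[set v in V | r K v]|.
  rewrite sum_card_exchange -sum_nat_const; apply: leq_sum => v vV.
  apply: (@leq_trans 'C(nbr S v, k)); first by apply/leq_bin2l/degV.
  rewrite -cards_draws; apply: subset_leq_card; apply/subsetP => K.
  rewrite !inE => /andP[/subsetP sK ->]; rewrite andbT; apply/andP; split.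
    by apply/subsetP => x /sK; rewrite inE => /andP[].
  by apply/completeP => x y /set1P-> /sK; rewrite inE => /andP[].
case: (posnP #|V|) => [V0|Vgt0].
  have: D != set0 by rewrite -card_gt0 cD bin_gt0.
  case/set0Pn => K; rewrite inE => /andP[sKS /eqP cK].
  by exists K, [set v in V | r K v]; split=> //; rewrite V0.
have D0 : D != set0 by rewrite -card_gt0 cD bin_gt0.
have [K KD] : exists2 K, K \in D & #|V| * 'C(g, k) <= #|[set v in V | r K v]| * #|D|.
  apply: exists_le_sum => //.
  rewrite -big_distrl /= leq_mul2r; apply/orP; right; exact: sumE.
move: (KD); rewrite inE => /andP[sKS /eqP cK]; rewrite cD => le.
by exists K, [set v in V | r K v].
Qed.

(** The step that attaches V to a small portion K of a much larger
    set Y, of which each vertex of V sees only a small proportion. *)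
Lemma many_common_kept Y V k q : 0 < k -> #|Y| <= q * k ->
  (forall v, v \in V -> 2 * k <= nbr Y v) -> k <= #|Y| ->
  exists K W, [/\ K \subset Y, #|K| = k, W \subset V, complete W K
     & #|V| <= #|W| * q ^ k].
Proof.
move=> k0 leY degV lekY.
have [K [W [sK cK -> le]]] := many_common_subset lekY degV.
exists K, [set v in V | complete [set v] K]; split=> //.
- by apply/subsetP => v; rewrite inE => /andP[].
- apply/completeP => x y; rewrite inE => /andP[_ /completeP H] yK.
  by apply: H => //; rewrite inE.
have P : 0 < 'C(2 * k, k) by rewrite bin_gt0; lia.
rewrite -(leq_pmul2r P); apply: leq_trans le _.
rewrite -mulnA leq_mul2l [q ^ k * _]mulnC; apply/orP; right.
exact: bin_kept_ratio.
Qed.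

Lemma popular_value V (f : T -> nat) y : (forall v, v \in V -> f v <= y) ->
  exists2 y0, y0 <= y & #|V| <= #|[set v in V | f v == y0]| * y.+1.
Proof.
move=> fle.
have E : #|V| = \sum_(i < y.+1) #|[set v in V | f v == i]|.
  rewrite -sum1_card (partition_big (fun v => inord (f v) : 'I_y.+1) xpredT) //=.
  apply: eq_bigr => i _; rewrite -sum1_card; apply: eq_bigl => v.
  rewrite inE; case vV: (v \in V) => //=.
  by rewrite -val_eqE /= inordK // ltnS fle.
have [i _ le] : exists2 i : 'I_y.+1, i \in [set: 'I_y.+1]
    & #|V| <= #|[set v in V | f v == i]| * y.+1.
  apply: exists_le_sum; first by apply/set0Pn; exists ord0; rewrite inE.
  rewrite cardsT card_ord -big_distrl /= leq_mul2r.
  apply/orP; right; rewrite E; apply: eq_leq.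
  by apply: eq_bigl => i; rewrite inE.
by exists i => //; rewrite -ltnS.
Qed.

(** The step that attaches V to S at the price of deleting from S
    the y vertices missed by a typical vertex of V and w further ones.  The
    number of missed vertices is first made the same for all vertices of V,
    which costs the factor y + 1.  In this way K contains all but w of the
    neighbours of each vertex that is kept, whichever parts of S they belong to. *)
Lemma many_common_removed S V y w q : 0 < w -> 0 < q -> #|S| <= q * w ->
  (forall v, v \in V -> nadj S v <= y) ->
  exists K W, [/\ K \subset S, W \subset V, complete W K,
     (forall v, v \in W -> nbr (S :\: K) v <= w)
     & #|V| <= #|W| * (y.+1 * q ^ y)].
Proof.
move=> w0 q0 leS nV.
have [y0 le_y0 leV] := popular_value nV.
set V0 := [set v in V | _] in leV.
have sV0 : V0 \subset V by apply/subsetP => v; rewrite inE => /andP[].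
have nV0 v : v \in V0 -> nadj S v = y0 by rewrite inE => /andP[_ /eqP].
have qle : q ^ y0 <= q ^ y by rewrite leq_pexp2l.
case: (leqP (y0 + w) #|S|) => [le_yS|lt_Sy]; last first.
  exists set0, V0; split=> //; first exact: sub0set.
  - by apply/completeP => x u _; rewrite inE.
  - move=> v vV0; rewrite setD0; have := nbrD S v; rewrite nV0 //; lia.
  apply: leq_trans leV _; rewrite leq_mul2l; apply/orP; right.
  by rewrite leq_pmulr // expn_gt0 q0.
have degV v : v \in V0 -> #|S| - y0 <= nbr S v.
  by move=> vV0; have := nbrD S v; rewrite nV0 //; lia.
have lek : #|S| - y0 - w <= #|S| by lia.
have [K [W [sK cK defW le]]] := many_common_subset lek degV.
have cWK : complete W K.
  apply/completeP => x u; rewrite defW inE => /andP[_ /completeP H] uK.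
  by apply: H => //; rewrite inE.
exists K, W; split=> //.
- by apply: subset_trans sV0; apply/subsetP => v; rewrite defW inE => /andP[].
- move=> v vW.
  have vV0 : v \in V0 by move: vW; rewrite defW inE => /andP[].
  have E : nbr S v = nbr (S :\: K) v + #|K|.
    rewrite /nbr -(cardsID K [set u in S | G v u]) addnC; congr (_ + _).
      by apply: eq_card => u; rewrite !inE andbA.
    apply: eq_card => u; rewrite !inE; case uK: (u \in K); rewrite ?andbF // andbT.
    by rewrite (subsetP sK _ uK) (completeP _ _ cWK).
  have := nbrD S v; rewrite nV0 // E cK; lia.
apply: leq_trans leV _.
suff: #|V0| <= #|W| * q ^ y0.
  move=> le0; rewrite (mulnC y.+1) mulnA leq_mul2r /=.
  by apply: leq_trans le0 _; rewrite leq_mul2l qle orbT.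
have P : 0 < 'C(#|S| - y0, #|S| - y0 - w) by rewrite bin_gt0; lia.
rewrite -(leq_pmul2r P); apply: leq_trans le _.
rewrite -mulnA leq_mul2l [q ^ y0 * _]mulnC; apply/orP; right.
by apply: (@bin_removed_ratio _ _ w) => //; lia.
Qed.

(** * Complete multipartite structures *)

(** The parts of a complete multipartite subgraph.  They are disjoint
    because adjacency is irreflexive, and empty parts are allowed. *)
Definition multipartite s := pairwise complete s.
Definition union s := \bigcup_(P <- s) P.
Definition large_parts b s := [seq P : {set T} <- s | b <= #|P|].
Definition small_parts b s := [seq P : {set T} <- s | #|P| < b].
Definition mass s := \sum_(P <- s) #|P|.

Lemma union_cons P s : union (P :: s) = P :|: union s.
Proof. by rewrite /union big_cons. Qed.

Lemma sub_union P s : P \in s -> P \subset union s.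
Proof.
elim: s => //= Q s IHs; rewrite inE union_cons => /predU1P[->|/IHs sP].
  exact: subsetUl.
exact: subset_trans sP (subsetUr _ _).
Qed.

Lemma complete_union A s : all (complete A) s -> complete A (union s).
Proof.
elim: s => [|P s IHs] /=.
  by move=> _; apply/completeP => x y _; rewrite /union big_nil inE.
case/andP => cAP /IHs cAs; rewrite union_cons complete_sym completeUl.
by rewrite !(complete_sym _ A) cAP.
Qed.

Lemma card_union s : multipartite s -> #|union s| = mass s.
Proof.
elim: s => [|P s IHs]; first by rewrite /union /mass !big_nil cards0.
rewrite /multipartite /= => /andP[/complete_union cP mps].
rewrite union_cons /mass big_cons -[\sum_(_ <- s) _]/(mass s) -IHs //.
have d := complete_disjoint cP.
by rewrite cardsU disjoint_setI0 // cards0 subn0.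
Qed.

Lemma multipartite_subparts (f : {set T} -> {set T}) s :
  (forall P, f P \subset P) -> multipartite s -> multipartite (map f s).
Proof.
move=> sf; rewrite /multipartite pairwise_map; apply: sub_pairwise => A B.
exact: completeS.
Qed.

Lemma all_complete_sub A K s : union s \subset K -> complete A K -> all (complete A) s.
Proof.
move=> sK cK; apply/allP => P Ps; apply: completeS cK => //.
by apply: subset_trans sK; apply: sub_union.
Qed.

Lemma union_restrict K s : union [seq P :&: K | P <- s] = union s :&: K.
Proof. by rewrite /union big_map big_distrl. Qed.

Lemma multipartite_attach A K s : complete A K -> multipartite s ->
  multipartite (A :: [seq P :&: K | P <- s]).
Proof.
move=> cAK mps; apply/andP; split.
  by apply: all_complete_sub cAK; rewrite union_restrict subsetIr.
by apply: multipartite_subparts => // P; apply: subsetIl.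
Qed.

Lemma contains_blowup s r b :
  multipartite s -> r < size s -> all (fun P => b <= #|P|) s ->
  contains_copy (complete_blowup r.+1 b) G.
Proof.
move=> mps ltrs /(all_nthP set0) leb.
case: b leb => [|b] leb.
  by exists (fun p : 'I_r.+1 * 'I_0 => False_rect T (notF (ltn_ord p.2))) => [[i []]|[i []]].
have [x0 _] : exists x0 : T, x0 \in nth set0 s 0.
  by apply/set0Pn; rewrite -card_gt0; exact: leq_trans (leb 0 (leq_ltn_trans (leq0n r) ltrs)).
pose f (p : 'I_r.+1 * 'I_b.+1) := nth x0 (enum (nth set0 s p.1)) p.2.
have lts (i : 'I_r.+1) : i < size s by apply: leq_trans ltrs.
have fin p : f p \in nth set0 s p.1.
  rewrite -mem_enum; apply: mem_nth; rewrite -cardE.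
  by apply: leq_trans (ltn_ord p.2) (leb _ _).
have adjf p p' : p.1 != p'.1 -> G (f p) (f p').
  move=> neq; have nat_neq : (p.1 : nat) != p'.1 by [].
  have cP i j : i < j -> j < size s -> complete (nth set0 s i) (nth set0 s j).
    move=> ltij ltj; move/(pairwiseP set0): (mps); apply => //.
    by rewrite inE; apply: ltn_trans ltj.
  case: (ltngtP p.1 p'.1) nat_neq => // lt _.
    by move/completeP: (cP _ _ lt (lts _)); apply.
  by rewrite adj_sym; move/completeP: (cP _ _ lt (lts _)); apply.
exists f => // p p' eqf.
have eq1 : p.1 = p'.1.
  by apply/eqP/negPn/negP => /adjf; rewrite eqf adj_irr.
have eq2 : p.2 = p'.2.
  apply/val_inj/eqP; move/eqP: eqf; rewrite /f eq1 nth_uniq ?enum_uniq //.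
    by rewrite -cardE; apply: leq_trans (ltn_ord p.2) (leb _ _).
  by rewrite -cardE; apply: leq_trans (ltn_ord p'.2) (leb _ _).
by case: p p' eq1 eq2 {eqf} => [? ?] [? ?] /= -> ->.
Qed.

(** Parts of size below b are merged one after the other; a group is
    closed as soon as it reaches size b, hence before it reaches 2 b.  A is the
    group under construction and L collects the sets that are finished. *)
Lemma greedy_groups b s L A :
  all (fun P => #|P| < b) s -> #|A| < b -> multipartite (A :: L ++ s) ->
  exists g, [/\ multipartite (L ++ g), all (fun P => b <= #|P|) g
     & #|A| + mass s < 2 * b * size g + b].
Proof.
elim: s L A => [|P s IHs] L A /=.
  rewrite cats0 /multipartite /= => _ ltA /andP[_ mpL].
  by exists [::]; rewrite cats0 /mass big_nil muln0 addn0; split.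
case/andP => ltP lts ltA mp.
have [cA cL mpL mps] : [/\ all (complete A) L && (complete A P && all (complete A) s),
   allrel complete L (P :: s), multipartite L & all (complete P) s && multipartite s].
  move: mp; rewrite /multipartite /= all_cat pairwise_cat /= => /and4P[].
  by case/and3P => -> -> -> -> -> ->.
case/and3P: cA => cAL cAP cAs; case/andP: mps => cPs mps.
have [cLP cLs] : all (complete^~ P) L /\ allrel complete L s.
  by move: cL; rewrite allrel_consr => /andP[].
have cPL : all (complete P) L.
  by apply: sub_all cLP => X; rewrite complete_sym.
have cardU : #|A :|: P| = #|A| + #|P|.
  by rewrite cardsU (disjoint_setI0 (complete_disjoint cAP)) cards0 subn0.
have allU s' : all (complete A) s' -> all (complete P) s' -> all (complete (A :|: P)) s'.
  move=> /allP aA /allP aP; apply/allP => Q Qs'.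
  by rewrite completeUl aA ?aP.
have massE : mass (P :: s) = #|P| + mass s by rewrite /mass big_cons.
case: (leqP b #|A :|: P|) => [geb|ltb].
  have [] := IHs (rcons L (A :|: P)) set0 lts.
  - by rewrite cards0; apply: leq_ltn_trans ltP.
  - rewrite /multipartite /= cat_rcons; apply/andP; split.
      by apply/allP => X _; apply/completeP => x y; rewrite inE.
    rewrite pairwise_cat /= allrel_consr cLs (mpL : pairwise _ _) (mps : pairwise _ _).
    rewrite allU // !andbT.
    apply/allP => X XL; rewrite complete_sym.
    by apply: (allP (allU _ cAL cPL)).
  move=> g [mpg lbg lt]; exists ((A :|: P) :: g); split.
  - by rewrite -cat_rcons.
  - by rewrite /= geb.
  - by rewrite massE /= mulnS; move: lt ltA ltP; rewrite cards0; clear; lia.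
have [] := IHs L (A :|: P) lts ltb.
  rewrite /multipartite /= all_cat !allU //= pairwise_cat cLs.
  by rewrite (mpL : pairwise _ _) (mps : pairwise _ _).
move=> g [mpg lbg lt]; exists g; split=> //.
by move: lt; rewrite massE cardU; clear; lia.
Qed.

Lemma group_small_parts b s : 0 < b -> multipartite s ->
  exists g, [/\ multipartite (large_parts b s ++ g),
     all (fun P => b <= #|P|) (large_parts b s ++ g)
     & mass (small_parts b s) < 2 * b * size g + b].
Proof.
move=> b0 mps; set L := large_parts b s.
have [||g [mpg lbg]] := @greedy_groups b (small_parts b s) L set0 (filter_all _ _).
- by rewrite cards0.
- rewrite /multipartite /=; apply/andP; split.
    by apply/allP => X _; apply/completeP => x y; rewrite inE.
  rewrite pairwise_cat !pairwise_filter // !andbT.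
  move: mps; rewrite /L /large_parts /small_parts; elim: (s) => //= P s' IHs' /andP[cP mps'].
  have cA (p : pred {set T}) : all (complete P) (filter p s').
    by apply/allP => X; rewrite mem_filter => /andP[_ /(allP cP)].
  case: ltnP => leb /=; rewrite ?allrel_consl ?allrel_consr IHs' // ?cA // andbT.
  by apply/allP => X XF; rewrite complete_sym; apply: (allP (cA _)) XF.
rewrite cards0 add0n => lt; exists g; split=> //.
by rewrite all_cat lbg filter_all.
Qed.

(** Large parts together with groups of small parts form a blow-up,
    so their total number is at most r. *)
Lemma blowup_free_parts r b s : 0 < b -> multipartite s ->
  ~ contains_copy (complete_blowup r.+1 b) G ->
  exists g, size (large_parts b s) + g <= r /\
    mass (small_parts b s) < 2 * b * g + b.
Proof.
move=> b0 mps free; have [g [mpg lbg lt]] := group_small_parts b0 mps.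
exists (size g); split=> //; rewrite leqNgt -size_cat; apply/negP => ltr.
by apply: free; apply: contains_blowup mpg ltr lbg.
Qed.

Lemma mass_split b s : mass s = mass (large_parts b s) + mass (small_parts b s).
Proof.
rewrite /mass !big_filter (bigID (fun P => b <= #|P|)) /=; congr (_ + _).
by apply: eq_bigl => P; rewrite ltnNge.
Qed.

Lemma mass_le_size (B : nat) s : all (fun P => #|P| <= B) s -> mass s <= size s * B.
Proof.
elim: s => [|P s IHs] /=; first by rewrite /mass big_nil.
case/andP => leP /IHs le; rewrite /mass big_cons mulSn leq_add //.
Qed.

Lemma mass_restrict K s : multipartite s ->
  mass [seq P :&: K | P <- s] + #|union s :\: K| = mass s.
Proof.
move=> mps; have mpK : multipartite [seq P :&: K | P <- s].
  by apply: multipartite_subparts => // P; apply: subsetIl.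
by rewrite -!card_union // union_restrict cardsID.
Qed.

Lemma subset_of_card A k : k <= #|A| -> exists2 B : {set T}, B \subset A & #|B| = k.
Proof.
move=> lek; have : 0 < #|[set B : {set T} | B \subset A & #|B| == k]|.
  by rewrite cards_draws bin_gt0.
by case/card_gt0P => B; rewrite inE => /andP[sB /eqP cB]; exists B.
Qed.

(** * Growth, and graphs with sparse complement *)

(** In a structure of maximal mass no growth step is possible: a
    step would add B vertices for at most y + w lost ones. *)
Lemma large_multipartite (B y w q N Mx : nat) :
  0 < w -> 0 < q -> y + w < B -> Mx <= q * w -> B * (y.+1 * q ^ y) <= N ->
  exists s, [/\ multipartite s, all (fun P => #|P| <= B) s
    & Mx <= mass s \/ #|[set v | nadj (union s) v <= y]| < N].
Proof.
move=> w0 q0 ltB leMx leN.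
pose state m := exists s, [/\ multipartite s, all (fun P => #|P| <= B) s & mass s = m].
have grow s : multipartite s -> all (fun P => #|P| <= B) s -> mass s < Mx ->
    N <= #|[set v | nadj (union s) v <= y]| ->
    exists s', [/\ multipartite s', all (fun P => #|P| <= B) s' & mass s < mass s'].
  move=> mps sB ltM; set V := [set v | _] => leV.
  have leU : #|union s| <= q * w by rewrite card_union //; apply: ltnW (leq_trans ltM leMx).
  have nV v : v \in V -> nadj (union s) v <= y by rewrite inE.
  have [K [W [sK sW cWK ltW leW]]] := many_common_removed w0 q0 leU nV.
  have leBW : B <= #|W|.
    rewrite -(leq_pmul2r (_ : 0 < y.+1 * q ^ y)) ?muln_gt0 ?expn_gt0 ?q0 //.
    by apply: leq_trans leN _; apply: leq_trans leV _.
  have [W' sW' cW'] := subset_of_card leBW.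
  have cWK' : complete W' K by apply: completeS cWK.
  have [v vW'] : exists v, v \in W' by apply/card_gt0P; rewrite cW'; apply: leq_ltn_trans ltB.
  have vW : v \in W by apply: (subsetP sW').
  exists (W' :: [seq P :&: K | P <- s]); split.
  - exact: multipartite_attach.
  - rewrite /= cW' leqnn all_map; apply: sub_all sB => P leP /=.
    by apply: leq_trans leP; apply/subset_leq_card/subsetIl.
  have E := mass_restrict K mps.
  have nv := nV v (subsetP sW _ vW).
  have nd : nadj (union s :\: K) v <= nadj (union s) v by apply/nadj_sub/subsetDl.
  have := nbrD (union s :\: K) v; have := ltW v vW; move: nv nd E ltB.
  rewrite [mass (W' :: _)]/mass big_cons cW' -[\sum_(_ <- [seq _ | _ <- _]) _]/(mass _).
  by clear; lia.
have st0 : state 0 by exists [::]; rewrite /mass big_nil.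
have stT m : state m -> m <= #|T|.
  by case=> s [mps _ <-]; rewrite -card_union // max_card.
have [s [mps sB maxs]] : exists s, [/\ multipartite s, all (fun P => #|P| <= B) s
    & forall s', multipartite s' -> all (fun P => #|P| <= B) s' -> mass s' <= mass s].
  have [m [stm maxm]] : exists m, state m /\ forall m', state m' -> m' <= m.
    by apply: ex_max_nat stT; exists 0.
  case: stm => s [mps sB eqm]; exists s; split=> // s' mps' sB'.
  by rewrite eqm; apply: maxm; exists s'.
exists s; split=> //.
case: (leqP Mx (mass s)) => [|ltM]; first by left.
right; rewrite ltnNge; apply/negP => /(grow s mps sB ltM)[s' [mps' sB' lt]].
by have := maxs s' mps' sB'; rewrite leqNgt lt.
Qed.

(** With l large parts, mass r B + b leaves at least
    (r - l) B + b vertices in small parts, enough for r + 1 - l groups. *)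
Lemma blowup_of_mass (r b B : nat) s : 0 < b -> 2 * b <= B -> multipartite s ->
  all (fun P => #|P| <= B) s -> r * B + b <= mass s ->
  contains_copy (complete_blowup r.+1 b) G.
Proof.
move=> b0 leB mps sB leM; apply: boolp.contrapT => free.
have [g [leg ltm]] := blowup_free_parts b0 mps free.
have E := mass_split b s.
have : mass (large_parts b s) <= size (large_parts b s) * B.
  by apply: mass_le_size; apply/allP => P; rewrite mem_filter => /andP[_ /(allP sB)].
set l := size _ in leg *; move=> lel.
have : g * (2 * b) <= g * B by rewrite leq_mul2l leB orbT.
have : (l + g) * B <= r * B by rewrite leq_mul2r leg orbT.
rewrite mulnDl (mulnC (2 * b)) in ltm *; move: ltm leM E lel; clear; lia.
Qed.

(** On average a vertex misses at most eps M vertices of a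
    structure with M vertices.  The number y exceeds this average by a factor
    21 / 20, so by Markov's inequality at least a proportion 1 / 21 of the
    vertices can be used for the next growth step, whenever M < r B + b. *)
Lemma blowup_of_few_missing (R : realType) (r b B y w q N : nat) (eps : R) :
  0 < b -> 2 * b <= B -> 0 < w -> 0 < q -> y + w < B -> r * B + b <= q * w ->
  B * (y.+1 * q ^ y) <= N -> 21 * N <= #|T| ->
  (forall v, ((nadj setT v)%:R <= eps * #|T|%:R)%R) ->
  (21%:R / 20%:R * (eps * (r * B + b)%:R) <= y.+1%:R)%R ->
  contains_copy (complete_blowup r.+1 b) G.
Proof.
move=> b0 leB w0 q0 ltB leMx leN leT miss ley.
have [s [mps sB]] := large_multipartite w0 q0 ltB leMx leN.
case=> [leM|few]; first exact: blowup_of_mass leM.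
apply: boolp.contrapT => free.
have ltM : mass s < r * B + b.
  by rewrite ltnNge; apply/negP => leM; apply/free/(blowup_of_mass b0 leB mps).
set Z := [set v | _] in few.
have cZ : #|~: Z| + #|Z| = #|T| by rewrite addnC cardsC.
have sum_le : y.+1 * #|~: Z| <= \sum_(v in [set: T]) nadj (union s) v.
  rewrite mulnC -sum_nat_const big_mkcond /= [X in _ <= X]big_mkcond /=.
  by apply: leq_sum => v _; rewrite !inE -ltnNge; case: ltnP.
have sumR : ((\sum_(v in [set: T]) nadj (union s) v)%:R <= (mass s)%:R * (eps * #|T|%:R) :> R)%R.
  rewrite sum_nadj natr_sum -(card_union mps) -sumr_const mulr_suml.
  by apply: ler_sum => u _; rewrite mul1r.
have N0 : 0 < N by apply: leq_trans leN; rewrite !muln_gt0 expn_gt0 q0 /=; move: ltB; case: (B).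
have T0 : (0 < #|T|%:R :> R)%R by rewrite ltr0n; apply: leq_trans leT; rewrite muln_gt0.
have v0 : exists v : T, true.
  have /card_gt0P[v _] : 0 < #|T| by apply: leq_trans leT; rewrite muln_gt0.
  by exists v.
have eps0 : (0 <= eps)%R.
  have [v _] := v0; have := miss v => /(le_trans (ler0n R _)).
  by rewrite pmulr_lge0.
have h1 : (y.+1%:R * #|~: Z|%:R <= (mass s)%:R * (eps * #|T|%:R) :> R)%R.
  by rewrite -natrM; apply: le_trans sumR; rewrite ler_nat.
have h2 : ((mass s)%:R * (eps * #|T|%:R) <= 20%:R / 21%:R * (y.+1%:R * #|T|%:R) :> R)%R.
  rewrite !mulrA ler_wpM2r // ?ler0n //.
  have h : ((mass s)%:R * eps <= eps * (r * B + b)%:R :> R)%R.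
    by rewrite mulrC ler_wpM2l // ler_nat ltnW.
  by move: h ley; set a := (_ * eps)%R; set c := (eps * _)%R; clear; lra.
have h3 : (#|~: Z|%:R <= 20%:R / 21%:R * #|T|%:R :> R)%R.
  rewrite -(ler_pM2l (_ : 0 < y.+1%:R :> R)%R) ?ltr0n //.
  by apply: le_trans h1 (le_trans h2 _); rewrite mulrCA.
have : (21 * #|~: Z| <= 20 * #|T|)%N.
  rewrite -(ler_nat R) !natrM; move: h3; clear; lra.
move: few leT cZ N0; clear; lia.
Qed.

Local Open Scope ring_scope.

(** * Attaching nearly complete classes *)

(** Markov's inequality, in a form that covers a zero threshold. *)
Lemma markov_card (R : realType) V (f : T -> R) (thr c : R) :
  (forall v, v \in V -> 0 <= f v) -> 0 <= thr ->
  \sum_(v in V) f v <= c * thr * #|V|%:R ->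
  0 <= c -> #|[set v in V | thr < f v]|%:R <= c * #|V|%:R.
Proof.
move=> f0; rewrite le_eqVlt => /predU1P[<-|thr0] sumle c0.
  have f_eq0 : \sum_(v in V) f v = 0.
    apply/eqP; rewrite eq_le sumr_ge0 // andbT; apply: le_trans sumle _.
    by rewrite mulr0 mul0r.
  rewrite (_ : [set v in V | _] = set0) ?cards0 ?mulr_ge0 ?ler0n //.
  apply/setP => v; rewrite !inE; apply/negP => /andP[vV].
  rewrite lt_neqAle => /andP[/negP nf _]; apply: nf; rewrite eq_sym.
  by move/eqP: f_eq0; rewrite psumr_eq0 // => /allP /(_ v); rewrite vV; apply; rewrite mem_index_enum.
rewrite -(ler_pM2l thr0) mulrCA mulrA; apply: le_trans sumle.
rewrite mulrC -sumr_const mulr_suml [X in _ <= X](big_setID [set v in V | thr < f v]) /=.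
apply: ler_wpDr.
  by apply: sumr_ge0 => v; rewrite inE => /andP[_ /f0].
rewrite (_ : V :&: _ = [set v in V | thr < f v]); last first.
  by apply/setP => v; rewrite !inE; case: (v \in V).
by apply: ler_sum => v; rewrite inE mul1r => /andP[_ /ltW].
Qed.

Lemma sum_nadj_weighted (R : realType) V Z (w : T -> R) :
  \sum_(v in V) \sum_(z in Z | ~~ G v z) w z
  = \sum_(z in Z) w z * (nadj V z)%:R.
Proof.
rewrite (exchange_big_dep (mem Z)) /=; last by move=> v z _ /andP[].
apply: eq_bigr => z zZ; rewrite -sumr_const mulr_sumr big_mkcond [RHS]big_mkcond /=.
apply: eq_bigr => v _; rewrite inE adj_sym zZ /=.
by case: (v \in V) => //=; case: (G z v) => //=; rewrite mulr1.
Qed.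

(** If x is missed with proportion m and a = 7 / 6 m, the expected
    loss of boosted weight at x is m e^(2 a).  The inequality bounds 7 / 6 of it
    by the gain e^(2 a) - 1 due to the boost.  It follows from
    (1 + a)^2 (1 - a) >= 1, which is true up to a = 0.618; it is used for
    m <= 25 / 48. *)
Lemma expR_damping (R : realType) (a : R) : 0 <= a -> a <= 61 / 100 ->
  a * expR (2 * a) <= expR (2 * a) - 1.
Proof.
move=> a0 a1.
have e1 := expR_ge1Dx a.
have -> : expR (2 * a) = expR a * expR a by rewrite -expRD; congr expR; ring.
have e2 : (1 + a) * (1 + a) <= expR a * expR a by apply: ler_pM => //; lra.
set E := expR a * expR a in e2 *.
suff : 1 <= (1 - a) * E by lra.
apply: (@le_trans _ _ ((1 - a) * ((1 + a) * (1 + a)))); last by apply: ler_wpM2l => //; lra.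
nra.
Qed.

Lemma multipartite_swap A B s : multipartite [:: A, B & s] -> multipartite [:: B, A & s].
Proof.
rewrite /multipartite /= complete_sym; case/andP=> /andP[cBA cA] /andP[cB ->].
by rewrite cBA cA cB.
Qed.

Section Embedding.
Variables (R : realType) (I : finType) (D : I -> {set T}).

Definition missfrac j x : R := (nadj (D j) x)%:R / #|D j|%:R.
(** The factor by which the weight of x grows when x survives the attachment of
    the class D j; the more likely x is to be lost, the larger the factor. *)
Definition boost j x : R := expR (2 * (7 / 6 * missfrac j x)).

Lemma missfrac_ge0 j x : 0 <= missfrac j x.
Proof. by rewrite divr_ge0 ?ler0n. Qed.

Lemma boost_ge1 j x : 1 <= boost j x.
Proof. by apply: le_trans (expR_ge1Dx _); have := missfrac_ge0 j x; lra. Qed.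

Lemma prod_boost_ge1 (r : seq I) x : 1 <= \prod_(j <- r) boost j x.
Proof.
elim: r => [|j r IHr]; first by rewrite big_nil.
by rewrite big_cons mulr_ege1 // boost_ge1.
Qed.

(** Two Markov estimates.  The vertices of D j missing more than 14
    times the average in the union of s form at most 1 / 14 of D j, and those
    by which the total boosted weight of Z would fall below the old total
    weight form at most 6 / 7 of it; 1 / 14 of D j remains. *)
Lemma good_candidates j Z s (om : T -> R) : (0 < #|D j|)%N ->
  (forall x, x \in Z -> 0 <= om x) -> (forall x, x \in Z -> missfrac j x <= 25 / 48) ->
  exists V, [/\ V \subset D j, (#|D j| <= 14 * #|V|)%N,
    (forall v, v \in V -> (nadj (union s) v)%:R <= 14 * \sum_(u in union s) missfrac j u)
    & forall v, v \in V -> \sum_(x in Z | ~~ G v x) om x * boost j x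
        <= \sum_(x in Z) om x * boost j x - \sum_(x in Z) om x].
Proof.
move=> D_gt0 om0 missZ.
have missE x : (nadj (D j) x)%:R = missfrac j x * #|D j|%:R.
  by rewrite divfK // gt_eqF // ltr0n.
pose F1 v := \sum_(x in Z | ~~ G v x) om x * boost j x.
pose F2 v : R := (nadj (union s) v)%:R.
pose thr1 := \sum_(x in Z) om x * boost j x - \sum_(x in Z) om x.
pose thr2 := 14 * \sum_(u in union s) missfrac j u.
have thr1E : thr1 = \sum_(x in Z) om x * (boost j x - 1).
  by rewrite /thr1 -sumrB; apply: eq_bigr => x _; rewrite mulrBr mulr1.
have thr1_ge0 : 0 <= thr1.
  by rewrite thr1E sumr_ge0 // => x xZ; rewrite mulr_ge0 ?om0 // subr_ge0 boost_ge1.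
have thr2_ge0 : 0 <= thr2.
  by rewrite mulr_ge0 // sumr_ge0 // => u _; apply: missfrac_ge0.
have sum1 : \sum_(v in D j) F1 v <= 6 / 7 * thr1 * #|D j|%:R.
  rewrite sum_nadj_weighted thr1E -mulrA mulr_suml mulr_sumr; apply: ler_sum => x xZ.
  have h : missfrac j x * boost j x <= 6 / 7 * (boost j x - 1).
    have := @expR_damping R (7 / 6 * missfrac j x).
    rewrite -/(boost j x).
    have -> : 0 <= 7 / 6 * missfrac j x by have := missfrac_ge0 j x; lra.
    have -> : 7 / 6 * missfrac j x <= 61 / 100 by have := missZ x xZ; lra.
    move=> /(_ isT isT); move: (boost j x) (missfrac j x) => e m; lra.
  rewrite missE; have o0 := om0 x xZ; have d0 := ler0n R #|D j|.
  move: h; set e := boost j x; set m := missfrac j x => h.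
  have := ler_wpM2l (mulr_ge0 o0 d0) h; move: (om x) #|D j|%:R => o d; lra.
have sum2 : \sum_(v in D j) F2 v <= 1 / 14 * thr2 * #|D j|%:R.
  rewrite /F2 -natr_sum sum_nadj natr_sum.
  have -> : 1 / 14 * thr2 = \sum_(u in union s) missfrac j u by rewrite /thr2; field.
  rewrite mulr_suml.
  by apply: ler_sum => u _; rewrite missE.
have F1_ge0 v : v \in D j -> 0 <= F1 v.
  move=> _; apply: sumr_ge0 => x /andP[xZ _].
  by rewrite mulr_ge0 ?om0 // (le_trans ler01 (boost_ge1 j x)).
have bad1 := markov_card F1_ge0 thr1_ge0 sum1 _.
have bad2 := markov_card (fun v _ => ler0n R (nadj (union s) v)) thr2_ge0 sum2 _.
set W1 := [set v in _ | _] in bad1; set W2 := [set v in _ | _] in bad2.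
exists (D j :\: (W1 :|: W2)); split.
- exact: subsetDl.
- rewrite -(ler_nat R) natrM.
  have cD : (#|D j :\: (W1 :|: W2)| + #|W1 :|: W2| >= #|D j|)%N.
    by rewrite -(cardsID (W1 :|: W2) (D j)) addnC leq_add2l subset_leq_card // subsetIr.
  have cU : (#|W1 :|: W2| <= #|W1| + #|W2|)%N by rewrite leq_card_setU.
  move: cD cU; rewrite -!(ler_nat R) !natrD.
  have := bad1 (divr_ge0 (ler0n _ _) (ler0n _ _)).
  have := bad2 (divr_ge0 ler01 (ler0n _ _)); lra.
- move=> v; rewrite !inE negb_or => /andP[/andP[_ n2] vD].
  by move: n2; rewrite vD -leNgt.
- move=> v; rewrite !inE negb_or => /andP[/andP[n1 _] vD].
  by move: n1; rewrite vD -leNgt.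
Qed.

End Embedding.

Section EmbeddingLoop.
Variables (R : realType) (I : finType) (D : I -> {set T}) (alpha : I -> R).
Local Notation missfrac := (@missfrac R I D).
Local Notation boost := (@boost R I D).
Variables (B z t q y : nat) (Delta kappa : R).
Hypothesis alphaP : forall j u, u \in D j -> \sum_(i | i != j) missfrac i u <= alpha j.
Hypothesis B0 : (0 < B)%N.
Hypothesis t0 : (0 < t)%N.
Hypothesis q0 : (0 < q)%N.
Hypothesis yP : z%:R + Delta <= y%:R.
Hypothesis D_large : forall j, (14 * (B * (y.+1 * q ^ y)) <= #|D j|)%N.

Let D_gt0 j : (0 < #|D j|)%N.
Proof.
by apply: leq_trans (D_large j); rewrite !muln_gt0 B0 expn_gt0 q0.
Qed.

Lemma sum_missfrac_rest j r u : u \in D j -> uniq (j :: r) ->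
  \sum_(i <- r) missfrac i u <= alpha j.
Proof.
move=> uD /= /andP[njr ur]; apply: le_trans (alphaP uD).
rewrite big_uniq //= big_mkcond [X in _ <= X]big_mkcond /=; apply: ler_sum => i _.
case: ifPn => [ir|_]; last by case: ifP => // _; apply: missfrac_ge0.
by case: eqP => // eqij; rewrite -eqij ir in njr.
Qed.

(** Attach a new part from each class D j, j in r, to Z and the parts
    of s.  Two invariants are maintained.  The total deficit delta of the parts
    of s, plus 14 times the average loss and the slack t to be expected from each
    remaining class, stays below Delta: attaching D j moves its share from the
    expected losses to the deficit.
    The total weight of Z decreases by at most t kappa in each step, since
    kappa bounds the weight of a single vertex up to the end. *)
Lemma embed_classes (r : seq I) Z s (om : T -> R) (delta phi : R) :
  uniq r -> multipartite (Z :: s) -> all (fun P => #|P| <= B)%N s -> (#|Z| <= z)%N ->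
  ((size s + size r) * B + z <= q * t)%N ->
  (size s * B)%:R - (mass s)%:R <= delta ->
  delta + 14 * (\sum_(u in union s) \sum_(j <- r) missfrac j u)
    + 14 * B%:R * \sum_(j <- r) alpha j + (size r * t)%:R <= Delta ->
  (forall x, x \in Z -> 0 <= om x) ->
  (forall x, x \in Z -> om x * \prod_(j <- r) boost j x <= kappa) ->
  (forall j x, j \in r -> x \in Z -> missfrac j x <= 25 / 48) ->
  phi <= \sum_(x in Z) om x -> 0 <= kappa ->
  exists Z' s', [/\ multipartite (Z' :: s'), all (fun P => #|P| <= B)%N s',
    size s' = (size s + size r)%N, (size s' * B)%:R - (mass s')%:R <= Delta
    & phi - (size r * t)%:R * kappa <= kappa * #|Z'|%:R].
Proof.
move=> ur mp sB leZ leS led leD om0 omk missZ lephi k0.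
elim: r Z s om delta phi ur mp sB leZ leS led leD om0 omk missZ lephi => [|j r IHr]
  Z s om delta phi ur mp sB leZ leS led leD om0 omk missZ lephi.
  exists Z, s; split=> //; first by rewrite addn0.
    apply: le_trans led _; move: leD; rewrite !big_nil.
    rewrite big1 => [|u _]; last by rewrite big_nil.
    by rewrite !mulr0 mul0n !addr0.
  rewrite mul0n mul0r subr0; apply: le_trans lephi _.
  rewrite mulr_natr -sumr_const; apply: ler_sum => x /omk.
  by rewrite big_nil mulr1.
have mps : multipartite s by case/andP: mp.
have cZs : complete Z (union s) by apply: complete_union; case/andP: mp.
have [V [sV leV badV phiV]] := @good_candidates R I D j Z s om (D_gt0 j) om0
  (fun x => missZ j x (mem_head _ _)).
pose S := Z :|: union s.
have SE : S = union (Z :: s) by rewrite union_cons.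
have massS : (#|S| <= q * t)%N.
  rewrite SE (card_union mp) /mass big_cons; apply: leq_trans leS.
  rewrite addnC leq_add //; apply: leq_trans (mass_le_size sB) _.
  by rewrite leq_mul2r leq_addr orbT.
pose thr := 14 * \sum_(u in union s) missfrac j u.
have delta_ge0 : 0 <= delta.
  by apply: le_trans led; rewrite subr_ge0 ler_nat mass_le_size.
have alpha_ge0 i : 0 <= alpha i.
  have /card_gt0P[u uD] := D_gt0 i; apply: le_trans (alphaP uD).
  by apply: sumr_ge0 => ? _; apply: missfrac_ge0.
have sumS_cons : \sum_(u in union s) \sum_(i <- j :: r) missfrac i u
   = \sum_(u in union s) missfrac j u + \sum_(u in union s) \sum_(i <- r) missfrac i u.
  by rewrite -big_split /=; apply: eq_bigr => u _; rewrite big_cons.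
have sumS_ge0 : 0 <= \sum_(u in union s) \sum_(i <- r) missfrac i u.
  by apply: sumr_ge0 => u _; apply: sumr_ge0 => i _; apply: missfrac_ge0.
have suma_ge0 : 0 <= B%:R * \sum_(i <- r) alpha i by rewrite mulr_ge0 ?sumr_ge0.
have Baj_ge0 : 0 <= B%:R * alpha j by rewrite mulr_ge0.
have thr_le : delta + thr + 14 * (B%:R * alpha j) + t%:R
    + 14 * \sum_(u in union s) \sum_(i <- r) missfrac i u
    + 14 * B%:R * \sum_(i <- r) alpha i + (size r * t)%:R <= Delta.
  move: leD; rewrite sumS_cons big_cons /= mulSn natrD /thr; lra.
have nV v : v \in V -> (nadj S v <= y)%N.
  move=> vV; rewrite -(ler_nat R); apply: le_trans yP.
  rewrite /S nadjU ?(complete_disjoint cZs) //.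
  rewrite natrD lerD //.
    rewrite ler_nat; apply: leq_trans leZ; apply/subset_leq_card/subsetP => x.
    by rewrite inE => /andP[].
  apply: le_trans (badV v vV) _; rewrite -/thr; move: thr_le.
  have := ler0n R t; have := ler0n R (size r * t); lra.
have [K [W [sK sW cWK ltW leW]]] := many_common_removed t0 q0 massS nV.
have leBW : (B <= #|W|)%N.
  rewrite -(leq_pmul2r (_ : 0 < y.+1 * q ^ y)%N) ?muln_gt0 ?expn_gt0 ?q0 //.
  apply: leq_trans leW; rewrite -(leq_pmul2l (_ : 0 < 14)%N) //.
  exact: leq_trans (D_large j) leV.
have [W' sW' cW'] := subset_of_card leBW.
have cWK' : complete W' K by apply: completeS cWK.
have [v vW'] : exists v, v \in W' by apply/card_gt0P; rewrite cW'.
have vV : v \in V by apply: (subsetP sW); apply: (subsetP sW').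
have W'D : W' \subset D j by apply: subset_trans sW' (subset_trans sW sV).
pose s1 := W' :: [seq P :&: K | P <- s].
have mp1 : multipartite (Z :&: K :: s1).
  by apply/multipartite_swap/(multipartite_attach cWK' mp).
have vW : v \in W by apply: (subsetP sW').
(* v sees all of K, and K contains all but t of the neighbours of v; so a lost
   vertex is missed by v or one of these t. *)
have lost : (#|union s :\: K|)%:R <= thr + t%:R :> R.
  rewrite -(nbrD (union s :\: K) v) natrD addrC lerD //.
    apply: le_trans (badV v vV); rewrite ler_nat.
    exact/nadj_sub/subsetDl.
  rewrite ler_nat; apply: leq_trans (ltW v vW); apply/nbr_sub/setSD/subsetUr.
have mass1 : mass s1 = (B + mass [seq P :&: K | P <- s])%N.
  by rewrite /mass big_cons cW'.
have massE := mass_restrict K mps.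
have led1 : (size s1 * B)%:R - (mass s1)%:R <= delta + (thr + t%:R).
  rewrite mass1 /= size_map mulSn !natrD opprD addrACA subrr add0r.
  by move: led lost; rewrite -massE natrD; lra.
have sumW' : \sum_(u in W') \sum_(i <- r) missfrac i u <= B%:R * alpha j.
  rewrite -cW' mulr_natl -sumr_const; apply: ler_sum => u uW'.
  by apply: sum_missfrac_rest => //; apply: (subsetP W'D).
have sum1 : \sum_(u in union s1) \sum_(i <- r) missfrac i u
    <= B%:R * alpha j + \sum_(u in union s) \sum_(i <- r) missfrac i u.
  have nn u : 0 <= \sum_(i <- r) missfrac i u.
    by apply: sumr_ge0 => i _; apply: missfrac_ge0.
  apply: (@le_trans _ _ (\sum_(u in W' :|: union s) \sum_(i <- r) missfrac i u)).
    rewrite big_mkcond [X in _ <= X]big_mkcond /=; apply: ler_sum => u _.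
    rewrite /s1 union_cons union_restrict !inE.
    case: (u \in W') => //=; case: (u \in union s) => //=.
    by case: ifP.
  apply: (@le_trans _ _ (\sum_(u in W') \sum_(i <- r) missfrac i u
      + \sum_(u in union s) \sum_(i <- r) missfrac i u)); last by rewrite lerD2r.
  rewrite [X in X + _]big_mkcond [X in _ + X]big_mkcond [X in X <= _]big_mkcond /= -big_split /=.
  apply: ler_sum => u _; rewrite inE; case: (u \in W') => /=; last by rewrite add0r.
  by rewrite lerDl; case: ifP.
have omb0 x : x \in Z -> 0 <= om x * boost j x.
  by move=> xZ; rewrite mulr_ge0 ?om0 // (le_trans ler01 (boost_ge1 _ _ _ _)).
have ombk x : x \in Z -> om x * boost j x <= kappa.
  move=> xZ; apply: le_trans (omk x xZ); rewrite big_cons mulrA ler_peMr ?omb0 //.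
  exact: prod_boost_ge1.
have [] := IHr (Z :&: K) s1 (fun x => om x * boost j x) (delta + (thr + t%:R)) (phi - t%:R * kappa).
- by case/andP: ur.
- by [].
- rewrite /= cW' leqnn all_map; apply: sub_all sB => P leP /=.
  by apply: leq_trans leP; apply/subset_leq_card/subsetIl.
- by apply: leq_trans leZ; apply/subset_leq_card/subsetIl.
- by rewrite /= size_map addSnnS.
- by [].
- by move: thr_le sum1; lra.
- by move=> x; rewrite inE => /andP[xZ _]; apply: omb0.
- move=> x; rewrite inE => /andP[xZ _].
  by have := omk x xZ; rewrite big_cons mulrA.
- move=> i x ir; rewrite inE => /andP[xZ _]; apply: missZ => //.
  by rewrite inE ir orbT.
- have phv := phiV v vV.
  have split1 : \sum_(x in Z) om x * boost j x = \sum_(x in Z :&: K) om x * boost j x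
      + \sum_(x in Z :\: K) om x * boost j x by rewrite -big_setID.
  have split2 : \sum_(x in Z :\: K) om x * boost j x
     <= \sum_(x in Z | ~~ G v x) om x * boost j x + t%:R * kappa.
    rewrite (bigID (fun x => G v x)) /= addrC lerD //.
      rewrite [X in X <= _]big_mkcond [X in _ <= X]big_mkcond /=; apply: ler_sum => x _.
      rewrite inE; case xZ: (x \in Z) => //=; rewrite ?andbF //=.
      by case: (x \in K) => //=; case: ifP => // _; apply: omb0.
    apply: (@le_trans _ _ (\sum_(x in [set x in Z :\: K | G v x]) kappa)).
      rewrite [X in X <= _]big_mkcond [X in _ <= X]big_mkcond /=; apply: ler_sum => x _.
      rewrite !inE; case: ifP => // /andP[/andP[_ xZ] _]; exact: ombk.
    rewrite sumr_const -[kappa *+ _]mulr_natl ler_wpM2r // ler_nat.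
    by apply: leq_trans (ltW v vW); apply/nbr_sub/setSD/subsetUl.
  by move: lephi; lra.
move=> Z' [s' [mp' sB' size' Delta' phi']]; exists Z', s'; split=> //.
  by rewrite size' /= size_map addSnnS.
by move: phi'; rewrite /= mulSn natrD; lra.
Qed.

End EmbeddingLoop.

Local Open Scope nat_scope.

(** * Graphs close to a Turan graph *)

Lemma sum_nadj_disjoint (I : finType) (p : pred I) (D : I -> {set T}) A u :
  (forall i j, i != j -> [disjoint D i & D j]) -> (forall i, p i -> D i \subset A) ->
  \sum_(i | p i) nadj (D i) u <= nadj A u.
Proof.
move=> dD sD.
have E (C : {set T}) : nadj C u = \sum_(x in C | ~~ G u x) 1.
  by rewrite sum1dep_card.
rewrite E; under eq_bigr do rewrite E.
rewrite (exchange_big_dep (fun x => (x \in A) && ~~ G u x)) /=; last first.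
  by move=> i x pi /andP[/(subsetP (sD i pi)) -> ->].
apply: leq_sum => x _; rewrite sum1dep_card.
apply/card_le1_eqP => i j; rewrite !inE => /and3P[_ xi _] /and3P[_ xj _].
by case: (eqVneq i j) => // /dD d; move: (disjointFr d xi); rewrite xj.
Qed.

Lemma part_deficit_le (B : nat) s P : all (fun P => #|P| <= B) s -> P \in s ->
  mass s + B <= size s * B + #|P|.
Proof.
elim: s => //= Q s IHs /andP[leQ sB]; rewrite inE /mass big_cons -/(mass s) mulSn.
case/predU1P => [->|Ps].
  by have := mass_le_size sB; clear; lia.
by have := IHs sB Ps; move: leQ; clear; lia.
Qed.

Lemma exp11_bound r : 2 <= r -> 512 * r ^ 2 <= r ^ 11.
Proof.
move=> hr; rewrite (_ : 11 = 9 + 2)%N // expnD leq_mul2r; apply/orP; right.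
by apply: (@leq_trans (2 ^ 9)) => //; rewrite leq_exp2r.
Qed.

Lemma expR_five_halves (R : realType) : (expR (5 / 2) <= 25 :> R)%R.
Proof.
have e1 := expR_ge1Dx (- (5 / 16) : R)%R.
have e8 : (expR (- (5 / 16)) ^+ 8 = expR (- (5 / 2)) :> R)%R.
  by rewrite -expRM_natl; congr expR; field.
have e2 : ((11 / 16) ^+ 8 <= expR (- (5 / 2)) :> R)%R.
  by rewrite -e8; apply: lerXn2r; rewrite ?nnegrE; lra.
have e3 : (1 / 25 <= expR (- (5 / 2)) :> R)%R.
  by apply: le_trans e2; lra.
rewrite -[X in expR X]opprK expRN -[leRHS]invrK lef_pV2 ?posrE ?expR_gt0 ?invr_gt0 //.
  by move: e3; rewrite mul1r.
Qed.

Section NearTuran.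
Variables (R : realType) (r t : nat) (D : 'I_r -> {set T}).
(* The slack t of one deletion adds up to b over r deletions; q bounds the ratio
   of the number of vertices of a structure to t. *)
Let b := r * t.
Let B := 320 * b.
Let q := r ^ 11.
Let y := 400 * b.
Let n := #|T|.
Hypothesis hr : 2 <= r.
Hypothesis t0 : 0 < t.
Hypothesis disjD : forall i j, i != j -> [disjoint D i & D j].
Hypothesis leD : forall i, r * #|D i| <= n.
(* The classes cover all but a proportion 1 / (25 r) of the vertices;
   a vertex of D i, having few neighbours in D i, has at most n / r - #|D i|
   non-neighbours elsewhere. *)
Hypothesis covD : 25 * (r * n) <= 25 * (r * \sum_i #|D i|) + n.
Hypothesis outD : forall i u, u \in D i -> r * nadj (~: D i) u + r * #|D i| <= n.
Hypothesis missT : forall v, 2 * r ^ 3 * nadj setT v + n <= 2 * r ^ 2 * n.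
Hypothesis n_large : 100 * 100 * r ^ 6 * (B * (y.+1 * q ^ y)) <= n.

Let r0 : 0 < r. Proof. exact: leq_trans hr. Qed.
Let b0 : 0 < b. Proof. by rewrite muln_gt0 r0. Qed.
Let q0 : 0 < q. Proof. by rewrite expn_gt0 r0. Qed.
Let N := B * (y.+1 * q ^ y).
Let N0 : 0 < N. Proof. by rewrite /N muln_gt0 [0 < B]muln_gt0 b0 muln_gt0 expn_gt0 q0. Qed.
Let n0 : 0 < n.
Proof. by apply: leq_trans n_large; rewrite muln_gt0 N0 muln_gt0 expn_gt0 r0. Qed.

(** The classes have size at most n / r and cover all but a proportion
    1 / (25 r) of the vertices, so none of them is much smaller than n / r. *)
Lemma class_lower j : 24 * n <= 25 * (r * #|D j|).
Proof.
have S : r * \sum_i #|D i| <= r * #|D j| + (r - 1) * n.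
  rewrite (bigD1 j) //= mulnDr leq_add2l big_distrr /=.
  apply: leq_trans (_ : \sum_(i | i != j) n <= _); first exact: leq_sum.
  by rewrite sum_nat_const cardC1 card_ord subn1.
have E : r * n = (r - 1) * n + n by rewrite -{1}(subnK r0) mulnDl mul1n.
move: covD S; rewrite E; move: (r * \sum_i _) (r * #|D j|) ((r - 1) * n).
clear; lia.
Qed.

Let miss := @missfrac R 'I_r D.
Let alpha i : R := ((n%:R / r%:R - #|D i|%:R) * (25 * r%:R / (24 * n%:R)))%R.

Let rR : (0 < r%:R :> R)%R. Proof. by rewrite ltr0n. Qed.
Let nR : (0 < n%:R :> R)%R. Proof. by rewrite ltr0n. Qed.

(** The factor is the inverse of the lower bound 24 n / (25 r) on the
    size of a class. *)
Lemma missfrac_le j x : (miss j x <= (nadj (D j) x)%:R * (25 * r%:R / (24 * n%:R)))%R.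
Proof.
rewrite /miss /missfrac ler_wpM2l ?ler0n //.
have := class_lower j; rewrite -(ler_nat R) !natrM => lo.
have d0 : (0 < #|D j|%:R :> R)%R.
  have: (0 < 25 * (r%:R * #|D j|%:R) :> R)%R by apply: lt_le_trans lo; rewrite mulr_gt0.
  by rewrite pmulr_rgt0 // pmulr_rgt0.
rewrite -[X in (X <= _)%R]mul1r ler_pdivrMr // mulrAC ler_pdivlMr ?mulr_gt0 //.
by rewrite mul1r -mulrA.
Qed.

Lemma alphaP i u : u \in D i -> (\sum_(j | j != i) miss j u <= alpha i)%R.
Proof.
move=> uD; have out := outD uD.
apply: le_trans (ler_sum _ (fun j _ => missfrac_le j u)) _.
rewrite -mulr_suml ler_wpM2r ?divr_ge0 ?mulr_ge0 ?ler0n //.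
have h : \sum_(j | j != i) nadj (D j) u <= nadj (~: D i) u.
  apply: sum_nadj_disjoint => // j neq; rewrite -disjoints_subset; exact: disjD.
rewrite -natr_sum lerBrDr ler_pdivlMr // -natrD -natrM ler_nat mulnC mulnDr.
by apply: leq_trans out; rewrite leq_add2r leq_mul2l h orbT.
Qed.

(** The numbers n / r - #|D i| add up to the number of vertices outside the
    classes. *)
Lemma sum_alpha : (\sum_i alpha i <= 1 / 24)%R.
Proof.
rewrite -mulr_suml sumrB sumr_const card_ord.
have -> : (n%:R / r%:R *+ r = n%:R :> R)%R by rewrite -mulr_natr divfK // gt_eqF.
rewrite -natr_sum; move: covD; rewrite -(ler_nat R) !natrD !natrM => cov.
by rewrite mulrA ler_pdivrMr ?mulr_gt0 //; move: cov; lra.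
Qed.

Lemma sum_missfrac x : (\sum_j miss j x <= 25 / 24)%R.
Proof.
apply: le_trans (ler_sum _ (fun j _ => missfrac_le j x)) _.
have h : \sum_j nadj (D j) x <= nadj setT x.
  by apply: sum_nadj_disjoint => // j _; apply: subsetT.
have h2 : r * nadj setT x <= n.
  rewrite -(leq_pmul2l (_ : 0 < 2 * r ^ 2)) ?muln_gt0 ?expn_gt0 ?r0 //.
  apply: leq_trans (missT x); rewrite mulnA -[2 * r ^ 2 * r]mulnA -expnSr.
  exact: leq_addr.
have h3 : r * \sum_j nadj (D j) x <= n by apply: leq_trans h2; rewrite leq_mul2l h orbT.
rewrite -mulr_suml -natr_sum; move: h3; rewrite -(ler_nat R) natrM => h3'.
by rewrite mulrA ler_pdivrMr ?mulr_gt0 //; move: h3'; lra.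
Qed.

Let closest i := [set x | [forall j, (miss j x <= miss i x)%R]].

(** The sets of vertices closest to a class cover the graph. *)
Lemma exists_large_closest : exists i, n <= r * #|closest i|.
Proof.
have [i _ le] : exists2 i, i \in [set: 'I_r] & n <= #|closest i| * r.
  apply: exists_le_sum; first by apply/set0Pn; exists (Ordinal r0); rewrite inE.
  rewrite cardsT card_ord -big_distrl leq_mul2r /=; apply/orP; right.
  have cov : [set: T] \subset \bigcup_i closest i.
    apply/subsetP => x _; apply/bigcupP.
    have [i _ maxi] := @Order.TotalTheory.arg_maxP _ _ 'I_r (Ordinal r0) xpredT (miss^~ x) isT.
    by exists i => //; rewrite inE; apply/forallP => j; apply: maxi.
  rewrite /n -cardsT; apply: leq_trans (subset_leq_card cov) _.
  apply: leq_trans (leq_card_bigcup _) _; apply: eq_leq.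
  by apply: eq_bigl => i; rewrite inE.
by exists i; rewrite mulnC.
Qed.

(** A vertex of D i has at most n / r - n / (2 r^3) non-neighbours,
    hence at least n / (2 r^3) neighbours in a set of n / r vertices.  So many
    vertices of closest i see a positive proportion of D i; among these Z0 is
    chosen, and Y and Z are obtained from the vertices of D i that see a
    positive proportion of Z0. *)
Lemma dense_pair : exists i Z Y, [/\ Z \subset closest i, #|Z| = 80 * b, Y \subset D i,
  #|Y| = B & complete Y Z].
Proof.
have [i lei] := exists_large_closest; exists i.
have d0 : 0 < #|D i|.
  have := class_lower i; case: #|D i| => // ; rewrite !muln0 leqn0 muln_eq0 /=.
  by move: n0; case: (n).
have deg u : u \in D i -> n <= 2 * r ^ 3 * nbr (closest i) u.
  move=> uD; have E := nbrD (closest i) u.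
  have h := nadj_sub u (subsetT (closest i)).
  have h1 : 2 * r ^ 2 * n <= 2 * r ^ 3 * #|closest i|.
    rewrite (_ : 2 * r ^ 3 * _ = 2 * r ^ 2 * (r * #|closest i|)).
      by rewrite leq_mul2l lei orbT.
    by rewrite (expnSr r 2); move: #|_| (r ^ 2); clear; lia.
  move: (missT u) h1; rewrite -E mulnDr.
  have : 2 * r ^ 3 * nadj (closest i) u <= 2 * r ^ 3 * nadj [set: T] u.
    by rewrite leq_mul2l h orbT.
  move: (2 * r ^ 3 * _) (2 * r ^ 3 * _) (2 * r ^ 3 * _) (2 * r ^ 2 * n); clear; lia.
pose Zs := [set z in closest i | #|D i| <= 4 * r ^ 3 * nbr (D i) z].
have leZs : n <= 4 * r ^ 3 * #|Zs|.
  have s1 : n * #|D i| <= 2 * r ^ 3 * \sum_(u in D i) nbr (closest i) u.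
    by rewrite mulnC -sum_nat_const big_distrr /=; apply: leq_sum.
  have s2 : 4 * r ^ 3 * \sum_(z in closest i) nbr (D i) z
     <= 4 * r ^ 3 * (#|Zs| * #|D i|) + n * #|D i|.
    rewrite (big_setID Zs) /= mulnDr; apply: leq_add.
      rewrite leq_mul2l; apply/orP; right; rewrite -sum_nat_const.
      rewrite (setIidPr _); last by apply/subsetP => z; rewrite inE => /andP[].
      by apply: leq_sum => z _; rewrite -(nbrD (D i) z) leq_addr.
    rewrite big_distrr /=; apply: (@leq_trans (\sum_(z in closest i :\: Zs) #|D i|)).
      apply: leq_sum => z; rewrite !inE negb_and => /andP[/orP[/negP//|]].
      by rewrite -ltnNge => /ltnW.
    by rewrite sum_nat_const leq_mul2r max_card orbT.
  rewrite sum_nbr in s1; rewrite -(leq_pmul2r d0).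
  move: s1 s2; move: (\sum_(u in _) _) (r ^ 3) n #|Zs| #|D i|; clear; lia.
have [Z0 sZ0 cZ0] : exists2 Z0 : {set T}, Z0 \subset Zs & #|Z0| = 1280 * r ^ 3 * b.
  apply: subset_of_card; rewrite -(leq_pmul2l (_ : 0 < 4 * r ^ 3)) ?muln_gt0 ?expn_gt0 ?r0 //.
  apply: leq_trans leZs; apply: leq_trans n_large.
  rewrite (_ : _ * _ = 16 * r ^ 6 * (B * 1)); last first.
    by rewrite /B (_ : 6 = 3 + 3)%N // expnD; move: (r ^ 3) b; clear; lia.
  apply: leq_mul; first by rewrite leq_mul2r orbT.
  by rewrite leq_mul2l muln_gt0 expn_gt0 q0 orbT.
(* Vertices of D i see on average a proportion 1 / (4 r^3) of Z0, that is 320 b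
   vertices. *)
pose V2 := [set v in D i | 2 * (80 * b) <= nbr Z0 v].
have leV2 : #|D i| <= 8 * r ^ 3 * #|V2|.
  have s1 : #|Z0| * #|D i| <= 4 * r ^ 3 * \sum_(v in D i) nbr Z0 v.
    rewrite sum_nbr -sum_nat_const big_distrr /=; apply: leq_sum => z.
    by move/(subsetP sZ0); rewrite inE => /andP[].
  have s2 : \sum_(v in D i) nbr Z0 v <= #|V2| * #|Z0| + #|D i| * (160 * b).
    rewrite (big_setID V2) /=; apply: leq_add.
      rewrite (setIidPr _); last by apply/subsetP => v; rewrite inE => /andP[].
      rewrite -sum_nat_const; apply: leq_sum => v _.
      by rewrite -(nbrD Z0 v) leq_addr.
    apply: (@leq_trans (\sum_(v in D i :\: V2) 160 * b)).
      apply: leq_sum => v; rewrite !inE negb_and => /andP[/orP[/negP//|]].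
      by rewrite -ltnNge mulnA => /ltnW.
    by rewrite sum_nat_const leq_mul2r subset_leq_card ?orbT // subsetDl.
  have s3 : 4 * r ^ 3 * \sum_(v in D i) nbr Z0 v
      <= 4 * r ^ 3 * (#|V2| * #|Z0| + #|D i| * (160 * b)) by rewrite leq_mul2l s2 orbT.
  have z0 : 0 < 640 * r ^ 3 * b by rewrite muln_gt0 b0 muln_gt0 expn_gt0 r0.
  rewrite -(leq_pmul2l z0); move: (leq_trans s1 s3); rewrite cZ0.
  move: (r ^ 3) b #|D i| #|V2|; clear; lia.
have kY : #|Z0| <= q * (80 * b).
  rewrite cZ0 (_ : 1280 * r ^ 3 * b = (16 * r ^ 3) * (80 * b)); last first.
    by move: (r ^ 3) b; clear; lia.
  rewrite leq_mul2r; apply/orP; right; rewrite /q (_ : 11 = 8 + 3)%N // expnD leq_mul2r.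
  by apply/orP; right; apply: (@leq_trans (2 ^ 8)) => //; rewrite leq_exp2r.
have k0 : 0 < 80 * b by rewrite muln_gt0.
have kY' : 80 * b <= #|Z0|.
  rewrite cZ0 leq_mul2r; apply/orP; right.
  by apply: leq_trans (_ : 1280 * 1 <= _) => //; rewrite leq_mul2l expn_gt0 r0.
have degV2 v : v \in V2 -> 2 * (80 * b) <= nbr Z0 v by rewrite inE => /andP[].
have [Z [W [sZ cZ sW cWZ leW]]] := many_common_kept k0 kY degV2 kY'.
have BW : B <= #|W|.
  have p0 : 0 < 25 * r * (8 * r ^ 3) * q ^ (80 * b).
    rewrite muln_gt0; apply/andP; split; last by rewrite expn_gt0 q0.
    by rewrite !muln_gt0 r0.
  rewrite -(leq_pmul2l p0).
  apply: (@leq_trans (24 * n)).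
    apply: leq_trans (leq_mul (leqnn 24) n_large).
    have e1 : q ^ (80 * b) <= q ^ y by rewrite leq_pexp2l // leq_mul2r orbT.
    apply: (@leq_trans (25 * r * (8 * r ^ 3) * q ^ y * B)).
      by rewrite leq_mul2r leq_mul2l e1 !orbT.
    have e2 : 25 * r * (8 * r ^ 3) <= 100 * 100 * r ^ 6.
      rewrite (_ : 25 * r * _ = 200 * r ^ 4); last by rewrite !expnS; lia.
      by apply: leq_mul => //; rewrite leq_pexp2l.
    apply: leq_trans (_ : 100 * 100 * r ^ 6 * q ^ y * B <= _).
      by rewrite !leq_mul2r e2 !orbT.
    apply: leq_trans (leq_pmull _ (_ : 0 < 24)) => //.
    rewrite -[_ * q ^ y * B]mulnA leq_mul2l; apply/orP; right.
    by rewrite mulnC leq_mul2l leq_pmull ?orbT.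
  apply: leq_trans (class_lower i) _.
  apply: (@leq_trans (25 * (r * (8 * r ^ 3 * (#|W| * q ^ (80 * b)))))).
    rewrite !leq_mul2l; apply/orP; right; apply/orP; right.
    by apply: leq_trans leV2 _; rewrite leq_mul2l leW orbT.
  by apply: eq_leq; move: (r ^ 3) (q ^ _) #|W|; clear; lia.
have [Y sY cY] := subset_of_card BW.
exists Z, Y; split=> //.
- apply: subset_trans sZ (subset_trans sZ0 _).
  by apply/subsetP => z; rewrite inE => /andP[].
- apply: subset_trans sY (subset_trans sW _).
  by apply/subsetP => z; rewrite inE => /andP[].
- by apply: completeS cWZ.
Qed.

(** For z closest to the class D i, the proportion of D j missed
    by z is at most the one of D i, and the sum of the proportions is at most
    25 / 24; hence the bound 25 / 48 for j other than i.  The weight of z ends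
    below exp (2 * 7 / 6 * 25 / 24) <= 25, while the total weight starts at
    80 b and loses at most 25 b. *)
Lemma blowup_of_near_turan : contains_copy (complete_blowup r.+1 b) G.
Proof.
have [i [Z [Y [sZ cZ sY cY cYZ]]]] := dense_pair.
pose rem := [seq j <- enum 'I_r | j != i].
have urem : uniq rem by rewrite filter_uniq ?enum_uniq.
have srem : size rem = r.-1.
  have := count_predC (pred1 i) (enum 'I_r).
  rewrite count_uniq_mem ?enum_uniq // mem_enum size_enum_ord size_filter => E.
  by apply/eqP; rewrite -eqSS prednK // -[X in _ == X]E.
have sumrem (f : 'I_r -> R) : (\sum_(j <- rem) f j = \sum_(j | j != i) f j)%R.
  by rewrite big_filter big_enum_cond; apply: eq_bigl => j.
have mpYZ : multipartite [:: Z; Y] by rewrite /multipartite /= complete_sym cYZ.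
have alpha0 j : (0 <= alpha j)%R.
  rewrite mulr_ge0 ?divr_ge0 ?mulr_ge0 ?ler0n // subr_ge0 ler_pdivlMr // -natrM ler_nat.
  by rewrite mulnC.
have sumaR : (alpha i + \sum_(j <- rem) alpha j <= 1 / 24)%R.
  by rewrite sumrem; have := sum_alpha; rewrite (bigD1 i).
have missZ x : x \in Z -> forall j, (miss j x <= miss i x)%R.
  by move/(subsetP sZ); rewrite inE => /forallP.
have leS : (size [:: Y] + size rem) * B + 80 * b <= q * t.
  rewrite srem /= add1n prednK // /B /b.
  have := leq_mul (exp11_bound hr) (leqnn t); rewrite -/q (_ : r ^ 2 = r * r) //.
  have : 1 * (r * t) <= r * (r * t) by rewrite leq_mul2r r0 orbT.
  by move: (q * t); clear; lia.
have leA : (0 + 14 * (\sum_(u in union [:: Y]) \sum_(j <- rem) miss j u)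
    + 14 * B%:R * \sum_(j <- rem) alpha j + (size rem * t)%:R <= (192 * b)%:R :> R)%R.
  have -> : union [:: Y] = Y by rewrite /union big_seq1.
  have s1 : (\sum_(u in Y) \sum_(j <- rem) miss j u <= B%:R * alpha i)%R.
    rewrite -cY mulr_natl -sumr_const; apply: ler_sum => u uY.
    by rewrite sumrem; apply/alphaP/(subsetP sY).
  have s2 : ((size rem * t)%:R <= b%:R :> R)%R.
    by rewrite ler_nat srem leq_mul2r leq_pred orbT.
  have s3 := ler_wpM2l (ler0n R B) sumaR; have b1 := ler0n R b.
  have BE : (B%:R = 320 * b%:R :> R)%R by rewrite natrM.
  rewrite (_ : (192 * b)%:R = 192 * b%:R :> R)%R; last by rewrite natrM.
  move: s1 s2 s3 b1; rewrite BE mulrDr; move: (b%:R)%R (_ * t)%:R%R => x w.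
  by move: (\sum_(u in Y) _)%R (\sum_(j <- rem) alpha j)%R => S1 S2; lra.
have D_large j : 14 * (B * (y.+1 * q ^ y)) <= #|D j|.
  have p0 : 0 < 25 * r by rewrite muln_gt0.
  rewrite -(leq_pmul2l p0) -[leqRHS]mulnA; apply: leq_trans (class_lower j).
  apply: (@leq_trans n); last by rewrite leq_pmull.
  apply: leq_trans n_large; rewrite mulnA leq_mul2r; apply/orP; right.
  rewrite mulnAC; apply: leq_mul => //.
  by rewrite -[X in X <= _]expn1 leq_pexp2l.
have yP : ((80 * b)%:R + (192 * b)%:R <= y%:R :> R)%R by rewrite -natrD ler_nat -mulnDl leq_mul2r orbT.
have B0 : 0 < B by rewrite muln_gt0.
have kap x : x \in Z -> ((1 : R) * \prod_(j <- rem) boost R D j x <= 25)%R.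
  move=> xZ; rewrite mul1r; apply: le_trans (expR_five_halves R).
  have -> : (\prod_(j <- rem) boost R D j x
      = expR (\sum_(j <- rem) 2 * (7 / 6 * miss j x)) :> R)%R.
    by rewrite expR_sum.
  rewrite ler_expR -!mulr_sumr.
  have : (\sum_(j <- rem) miss j x <= \sum_j miss j x)%R.
    by rewrite sumrem [leRHS](bigD1 i) //= lerDr missfrac_ge0.
  by have := sum_missfrac x; lra.
have missZ' j x : j \in rem -> x \in Z -> (miss j x <= 25 / 48)%R.
  rewrite mem_filter => /andP[neq _] xZ; have := sum_missfrac x; have := missZ x xZ j.
  rewrite (bigD1 i) //= (bigD1 j) //=.
  have : (0 <= \sum_(k < r | (k != i) && (k != j)) miss k x)%R.
    by apply: sumr_ge0 => k _; apply: missfrac_ge0.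
  by lra.
have sB : all (fun P => #|P| <= B) [:: Y] by rewrite /= cY leqnn.
have led : ((size [:: Y] * B)%:R - (mass [:: Y])%:R <= 0 :> R)%R.
  by rewrite /mass big_seq1 cY mul1n subrr.
have leZ : #|Z| <= 80 * b by rewrite cZ.
have ph : ((80 * b)%:R <= \sum_(x in Z) (1 : R))%R by rewrite sumr_const cZ.
have k0 : (0 <= 25 :> R)%R by [].
have [Z' [s' [mp' sB' size' Del phi']]] := embed_classes alphaP B0 t0 q0 yP D_large urem
  mpYZ sB leZ leS led leA (fun x _ => ler01) kap missZ' ph k0.
apply: (contains_blowup mp').
  by rewrite /= size' srem /= add1n prednK.
have le_rt : size rem * t <= b by rewrite srem leq_mul2r leq_pred orbT.
apply/andP; split.
  have : (80 * b <= 25 * #|Z'| + size rem * t * 25)%N.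
    by rewrite -(ler_nat R) natrD [(25 * _)%:R%R]natrM [(_ * 25)%:R%R]natrM -lerBlDr.
  by move: le_rt; clear; lia.
apply/allP => P Ps'; have := part_deficit_le sB' Ps'.
have : (size s' * B <= 192 * b + mass s')%N.
  by rewrite -(ler_nat R) natrD -lerBlDr.
by rewrite /B; move: (size s' * _); clear; lia.
Qed.

End NearTuran.

(** * Structures of maximal mass when eps is close to 1 / r *)

Section NearExtremal.
Variables (r t : nat).
Let b := r * t.
Let B := 320 * b.
Let q := r ^ 11.
Let n := #|T|.
Let N := B * ((400 * b).+1 * q ^ (400 * b)).
Hypothesis hr : 2 <= r.
Hypothesis t0 : 0 < t.
Hypothesis missT : forall v, 2 * r ^ 3 * nadj setT v + n <= 2 * r ^ 2 * n.
Hypothesis n_large : 100 * 100 * r ^ 6 * N <= n.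
Hypothesis free : ~ contains_copy (complete_blowup r.+1 b) G.

Let r0 : 0 < r. Proof. exact: leq_trans hr. Qed.
Let b0 : 0 < b. Proof. by rewrite muln_gt0 r0. Qed.
Let q0 : 0 < q. Proof. by rewrite expn_gt0 r0. Qed.
Let le_tb : t <= b. Proof. by rewrite leq_pmull. Qed.
Let N0 : 0 < N. Proof. by rewrite /N muln_gt0 [0 < B]muln_gt0 b0 muln_gt0 expn_gt0 q0. Qed.
Let n0 : 0 < n.
Proof. by apply: leq_trans n_large; rewrite muln_gt0 N0 muln_gt0 expn_gt0 r0. Qed.

Let n_large2 : 2 * (100 * r) * (100 * r) * N <= n.
Proof.
apply: leq_trans n_large; rewrite leq_mul2r; apply/orP; right.
have h : r ^ 2 * 2 <= r ^ 6.
  rewrite (_ : 6 = 2 + 4)%N // expnD leq_mul2l; apply/orP; right.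
  by apply: (@leq_trans (2 ^ 4)) => //; rewrite leq_exp2r.
have -> : 2 * (100 * r) * (100 * r) = 100 * 100 * (r ^ 2 * 2).
  by rewrite (_ : r ^ 2 = r * r) //; clear; lia.
by rewrite leq_mul2l h orbT.
Qed.

Let miss_n v : r * nadj setT v <= n.
Proof.
have p0 : 0 < 2 * r ^ 2 by rewrite muln_gt0 expn_gt0 r0.
rewrite -(leq_pmul2l p0); apply: leq_trans (missT v).
apply: leq_trans (leq_addr _ _); rewrite mulnA leq_mul2r; apply/orP; right.
by rewrite -[2 * r ^ 2 * r]mulnA -expnSr.
Qed.

Let rB_le : r * B + b <= q * t.
Proof.
have := leq_mul (exp11_bound hr) (leqnn t); rewrite -/q (_ : r ^ 2 = r * r) //.
have : 1 * (r * t) <= r * (r * t) by rewrite leq_mul2r r0 orbT.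
by rewrite /B /b; move: (q * t); clear; lia.
Qed.

(** Let s be a structure of maximal mass M.  As almost every vertex
    misses at least B - t vertices of s and vertices have fewer than n / r
    non-neighbours, M >= r B - 2 b; as no r + 1 groups can be formed,
    M < r B + b, the structure has exactly r large parts, and its small parts
    together have less than b vertices.  The upper bound on M makes the average
    number of missed vertices at most B + t, so that by Markov's inequality
    only a proportion of order 1 / r of the vertices misses more than
    B + B / 4 = 400 b. *)
Lemma free_structure : exists L S, [/\ multipartite L, size L = r,
  (forall P, P \in L -> [/\ #|P| <= B, B <= #|P| + 3 * b & P \subset S])
  & 80 * r * #|[set v | 400 * b < nadj S v]| <= 3 * n].
Proof.
have ltB : B.-1 - t + t < B.
  by rewrite subnK /B; [|rewrite -ltnS]; move: le_tb b0; clear; lia.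
have hN : B * ((B.-1 - t).+1 * q ^ (B.-1 - t)) <= N.
  have le400 : B.-1 - t <= 400 * b by rewrite /B; move: b; clear; lia.
  rewrite /N leq_mul2l; apply/orP; right; apply: leq_mul => //.
  by rewrite leq_pexp2l.
have b2 : 2 * b <= B by rewrite /B leq_mul2r orbT.
have [s [mps sB]] := large_multipartite t0 q0 ltB rB_le hN.
case=> [leM|]; first by case: free; apply: (blowup_of_mass b0 b2 mps).
set Z := [set v | _] => few.
have ltM : mass s < r * B + b.
  by rewrite ltnNge; apply/negP => leM; apply: free; apply: (blowup_of_mass b0 b2 mps).
set S := union s in Z few *.
pose X := [set v | 400 * b < nadj S v].
pose sum := \sum_(v in [set: T]) nadj S v.
have sum_up : r * sum <= mass s * n.
  rewrite /sum sum_nadj big_distrr /= -(card_union mps) -sum_nat_const.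
  by apply: leq_sum => u _; apply: miss_n.
(* Vertices outside Z miss at least B - t vertices, those of X at least 80 b more. *)
have sum_lo : (B - t) * n + 80 * b * #|X| <= sum + (B - t) * #|Z|.
  have E (A : {set T}) c : c * #|A| = \sum_(v in [set: T]) (v \in A) * c.
    rewrite mulnC -sum_nat_const big_mkcond [RHS]big_mkcond /=.
    by apply: eq_bigr => v _; rewrite inE; case: (v \in A); rewrite ?mul1n.
  rewrite {1}/n -cardsT !E -!big_split /=; apply: leq_sum => v _.
  rewrite !inE; have := le_tb; have := b0; rewrite /B.
  by case: (leqP (nadj S v)); case: (ltnP (400 * b)); clear; lia.
have BN : B * N <= t * n.
  rewrite /B /b; apply: leq_trans (leq_mul (leqnn t) n_large2).
  have : 1 * (r * (t * N)) <= r * (r * (t * N)) by rewrite leq_mul2r r0 orbT.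
  by clear; lia.
have ZB : (B - t) * #|Z| <= t * n.
  by apply: leq_trans BN; apply: leq_mul; [apply: leq_subr | apply: ltnW].
have rt : r * t = b by [].
have Bt : B - t + t = B by rewrite subnK // /B; move: le_tb; clear; lia.
have low : r * B <= mass s + 2 * b.
  rewrite -(leq_pmul2r n0) mulnDl; apply: leq_trans (leq_add sum_up (leqnn _)).
  have : r * ((B - t) * n) <= r * sum + r * (t * n).
    rewrite -mulnDr leq_mul2l; apply/orP; right.
    by move: sum_lo ZB; clear; lia.
  rewrite -[X in r * X * _]Bt -rt; move: (B - t) (r * sum); clear; lia.
have Xle : 80 * r * #|X| <= 3 * n.
  have sum_up2 : sum <= (B + t) * n.
    rewrite -(leq_pmul2l r0); apply: leq_trans sum_up _.
    by rewrite mulnA mulnDr rt leq_mul2r ltnW ?orbT.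
  rewrite -(leq_pmul2l t0).
  have -> : t * (80 * r * #|X|) = 80 * b * #|X| by rewrite /b; move: #|X|; clear; lia.
  move: sum_lo ZB sum_up2; rewrite -[X in (X + t) * n]Bt; move: (80 * b * _) (B - t) (sum) (n) => x c.
  by clear; lia.
have [g [leg ltm]] := blowup_free_parts b0 mps free.
have mE := mass_split b s.
pose L := large_parts b s.
have LB : all (fun P => #|P| <= B) L.
  by apply/allP => P; rewrite mem_filter => /andP[_ /(allP sB)].
have mL := mass_le_size LB.
have [sL gE] : size L = r /\ g = 0.
  have : r * B < size L * B + 2 * b * g + 3 * b.
    by move: ltm mE mL low; rewrite -/L; move: (size L * B); clear; lia.
  rewrite /B; move: leg b0; rewrite -/L; move: (size L) b; clear; nia.
exists L, S; split=> //.
  by apply: pairwise_filter.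
move=> P PL; split.
- exact: (allP LB).
- have := part_deficit_le LB PL; move: ltm mE low; rewrite gE sL -/L; clear; lia.
- by apply: sub_union; move: PL; rewrite mem_filter => /andP[].
Qed.

Section Classes.
Variables (L : seq {set T}) (S : {set T}).
Hypothesis mpL : multipartite L.
Hypothesis sizeL : size L = r.
Hypothesis partL : forall P, P \in L -> [/\ #|P| <= B, B <= #|P| + 3 * b & P \subset S].
Hypothesis fewL : 80 * r * #|[set v | 400 * b < nadj S v]| <= 3 * n.

Let part (i : 'I_r) := nth set0 L i.
Let V := [set v | nadj S v <= 400 * b].
Let cls i := [set v in V | nbr (part i) v < 2 * b].
Let others i := [seq part j | j <- enum 'I_r & j != i].

Let partP i : part i \in L. Proof. by rewrite mem_nth ?sizeL. Qed.

Lemma part_complete i j : i != j -> complete (part i) (part j).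
Proof.
wlog lt_ij : i j / i < j => [W neq|_].
  have: (i : nat) != j by [].
  case: ltngtP => // [/W|/W] lt _; first exact: lt.
  by rewrite complete_sym lt // eq_sym.
by move/(pairwiseP set0): mpL; apply; rewrite ?inE ?sizeL.
Qed.

Lemma multipartite_others i : multipartite (others i).
Proof.
rewrite /others /multipartite pairwise_map.
apply: (@sub_pairwise _ (fun x y => x != y)) => [x y|]; first exact: part_complete.
by rewrite -uniq_pairwise filter_uniq ?enum_uniq.
Qed.

Lemma othersP i P : P \in others i -> P \in L.
Proof. by case/mapP => j _ ->. Qed.

Lemma complete_part_others i : complete (part i) (union (others i)).
Proof.
apply: complete_union; apply/allP => P /mapP[j]; rewrite mem_filter => /andP[neq _] ->.
by apply: part_complete; rewrite eq_sym.
Qed.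

Lemma union_sub s A : (forall P, P \in s -> P \subset A) -> union s \subset A.
Proof.
elim: s => [|P s IHs] sA; first by rewrite /union big_nil sub0set.
rewrite union_cons subUset sA ?mem_head //; apply: IHs => Q Qs; apply: sA.
by rewrite inE Qs orbT.
Qed.

Lemma class_misses_part i v : v \in cls i -> 315 * b <= nadj (part i) v.
Proof.
rewrite inE => /andP[_]; have [_] := partL (partP i).
by rewrite -(nbrD (part i) v) /B; clear; lia.
Qed.

(** At most 400 b missed vertices in all, of which at least 315 b
    in the part of the class. *)
Lemma class_misses_others i v : v \in cls i -> nadj (union (others i)) v <= 85 * b.
Proof.
move=> vC; have h := class_misses_part vC.
have vV : nadj S v <= 400 * b by move: vC; rewrite !inE => /andP[].
have d := complete_disjoint (complete_part_others i).
have sub : part i :|: union (others i) \subset S.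
  rewrite subUset; apply/andP; split; first by case: (partL (partP i)).
  by apply: union_sub => P /othersP/partL[].
by have := nadj_sub v sub; rewrite nadjU //; move: h vV; clear; lia.
Qed.

(** Almost all of two parts would be 630 b missed vertices, while at most 400 b
    are missed. *)
Lemma class_disjoint i j : i != j -> [disjoint cls i & cls j].
Proof.
move=> neq; rewrite disjoint_subset; apply/subsetP => v vi; rewrite inE; apply/negP => vj.
have hi := class_misses_part vi; have hj := class_misses_part vj.
have vV : nadj S v <= 400 * b by move: vi; rewrite !inE => /andP[].
have d := complete_disjoint (part_complete neq).
have sub : part i :|: part j \subset S.
  by rewrite subUset; case: (partL (partP i)) => _ _ ->; case: (partL (partP j)).
by have := nadj_sub v sub; rewrite nadjU //; move: hi hj vV b0; clear; lia.
Qed.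

Lemma mass_L_le s : {subset s <= L} -> size s <= r -> multipartite s -> #|union s| <= q * t.
Proof.
move=> sL szs mps; rewrite (card_union mps); apply: leq_trans rB_le.
apply: leq_trans (leq_addr _ _); apply: leq_trans (_ : size s * B <= _).
  by apply: mass_le_size; apply/allP => P /sL/partL[].
by rewrite leq_mul2r szs orbT.
Qed.

(** Vertices with 2 b neighbours in each of the r parts provide a part
    number r + 1.  The deletion keeps all but t <= b of the neighbours of the
    chosen vertices, so at least b vertices survive in every part, even though
    the deleted vertices may be concentrated in a single part. *)
Lemma few_extending : #|[set v in V | [forall i, 2 * b <= nbr (part i) v]]| < N.
Proof.
set W0 := [set v in _ | _]; rewrite ltnNge; apply/negP => leN.
have leU : #|union L| <= q * t by apply: mass_L_le; rewrite ?sizeL.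
have nV v : v \in W0 -> nadj (union L) v <= 400 * b.
  rewrite !inE => /andP[vV _]; apply: leq_trans vV; apply: nadj_sub.
  by apply: union_sub => P /partL[].
have [K [W [sK sW cWK ltW leW]]] := many_common_removed t0 q0 leU nV.
have BW : B <= #|W|.
  rewrite -(leq_pmul2r (_ : 0 < (400 * b).+1 * q ^ (400 * b))); last first.
    by rewrite muln_gt0 expn_gt0 q0.
  by apply: leq_trans leW.
have bW : b <= #|W| by apply: leq_trans BW; rewrite leq_pmull.
have [W' sW' cW'] := subset_of_card bW.
have cWK' : complete W' K by apply: completeS cWK.
have [v vW'] : exists v, v \in W' by apply/card_gt0P; rewrite cW'.
have vW := subsetP sW' _ vW'.
apply: free; apply: (@contains_blowup (W' :: [seq P :&: K | P <- L])).
- exact: multipartite_attach.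
- by rewrite /= size_map sizeL.
rewrite /= cW' leqnn all_map; apply/allP => P PL /=.
have [i -> /=] : exists i, P = part i.
  have ltP : index P L < r by rewrite -sizeL index_mem.
  by exists (Ordinal ltP); rewrite /part /= nth_index.
have := subsetP sW _ vW; rewrite inE => /andP[_ /forallP/(_ i)].
have E : nbr (part i) v = nbr (part i :&: K) v + nbr (part i :\: K) v.
  rewrite /nbr -(cardsID K [set u in part i | G v u]); congr (_ + _);
    by apply: eq_card => u; rewrite !inE; case: (u \in K); rewrite ?andbF ?andbT.
have sub : part i :\: K \subset union L :\: K by apply/setSD/sub_union.
have := nbr_sub v sub; have := ltW v vW; have := nbrD (part i :&: K) v.
by rewrite E; move: le_tb; clear; lia.
Qed.

Let heavy i := [set u in cls i | n <= 2 * r ^ 3 * nbr (cls i) u].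

(** Many vertices with a positive proportion of neighbours inside their
    class give two parts in the class.  A large set Y of such vertices is
    attached to the other parts first; then vertices of the class with many
    neighbours in Y are attached to a small portion of Y, and finally to what
    remains of the other parts.  This order works because each
    vertex of the class misses at most 85 b vertices of the other parts, so
    that two deletions leave more than b vertices in each of them. *)
Lemma few_heavy i : #|heavy i| < N.
Proof.
rewrite ltnNge; apply/negP => leN.
have ho : #|union (others i)| <= q * t.
  apply: mass_L_le; [by move=> P; apply: othersP | | exact: multipartite_others].
  rewrite size_map size_filter; apply: leq_trans (count_size _ _) _.
  by rewrite size_enum_ord.
have nH v : v \in heavy i -> nadj (union (others i)) v <= 85 * b.
  by rewrite inE => /andP[/class_misses_others].
have [K1 [V1 [sK1 sV1 cV1 ltV1 leV1]]] := many_common_removed t0 q0 ho nH.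
have q_pos m : 0 < q ^ m by rewrite expn_gt0 q0.
(* On average a vertex of the class sees a proportion 1 / (2 r^3) of a set of
   heavy vertices, that is 4 b vertices out of 8 r^3 b. *)
have Y0 : 8 * r ^ 3 * b <= #|V1|.
  have p0 : 0 < (85 * b).+1 * q ^ (85 * b) by rewrite muln_gt0 q_pos.
  rewrite -(leq_pmul2r p0); apply: leq_trans leV1; apply: leq_trans leN.
  have e1 : r ^ 3 * q ^ (85 * b) <= q ^ (400 * b).
    apply: (@leq_trans (q ^ (85 * b).+1)).
      rewrite [q ^ _.+1]expnS leq_mul2r; apply/orP; right.
      by rewrite leq_pexp2l.
    by rewrite leq_pexp2l //; move: b0; clear; lia.
  have e2 : (85 * b).+1 <= (400 * b).+1 by rewrite ltnS leq_mul2r orbT.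
  rewrite /N /B; apply: leq_trans (_ : 320 * b * ((400 * b).+1 * (r ^ 3 * q ^ (85 * b))) <= _).
    rewrite (_ : 8 * r ^ 3 * b * ((85 * b).+1 * q ^ (85 * b))
        = 8 * b * ((85 * b).+1 * (r ^ 3 * q ^ (85 * b)))).
      by apply: leq_mul; [rewrite leq_mul2r orbT | rewrite leq_mul2r e2 orbT].
    by move: (r ^ 3) (q ^ (85 * b)) (85 * b).+1 b; clear; lia.
  by rewrite !leq_mul2l e1 !orbT.
have [Y sY cY] := subset_of_card Y0.
have Ypos : 0 < 8 * r ^ 3 * b by rewrite muln_gt0 b0 muln_gt0 expn_gt0 r0.
pose V2 := [set v in cls i | 2 * b <= nbr Y v].
have leV2 : n <= 4 * r ^ 3 * #|V2|.
  have s1 : #|Y| * n <= 2 * r ^ 3 * \sum_(v in cls i) nbr Y v.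
    rewrite sum_nbr -sum_nat_const big_distrr /=; apply: leq_sum => u.
    by move/(subsetP sY)/(subsetP sV1); rewrite inE => /andP[].
  have s2 : \sum_(v in cls i) nbr Y v <= #|V2| * #|Y| + n * (2 * b).
    rewrite (big_setID V2) /=; apply: leq_add.
      rewrite (setIidPr _); last by apply/subsetP => v; rewrite inE => /andP[].
      rewrite -sum_nat_const; apply: leq_sum => v _.
      by rewrite -(nbrD Y v) leq_addr.
    apply: (@leq_trans (\sum_(v in cls i :\: V2) 2 * b)).
      apply: leq_sum => v; rewrite in_setD inE negb_and => /andP[/orP[/negP//|]].
      by rewrite -ltnNge => /ltnW.
    by rewrite sum_nat_const leq_mul2r max_card orbT.
  have s3 : 2 * r ^ 3 * \sum_(v in cls i) nbr Y v
      <= 2 * r ^ 3 * (#|V2| * #|Y| + n * (2 * b)) by rewrite leq_mul2l s2 orbT.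
  have z0 : 0 < 4 * r ^ 3 * b by rewrite muln_gt0 b0 muln_gt0 expn_gt0 r0.
  rewrite -(leq_pmul2l z0); move: (leq_trans s1 s3); rewrite cY.
  by move: (r ^ 3) (b) (n) #|V2|; clear; lia.
have r3q : 8 * r ^ 3 <= q.
  rewrite /q (_ : 11 = 8 + 3)%N // expnD leq_mul2r; apply/orP; right.
  by apply: (@leq_trans (2 ^ 8)) => //; rewrite leq_exp2r.
have kY : #|Y| <= q * b by rewrite cY leq_mul2r r3q orbT.
have kY' : b <= #|Y| by rewrite cY leq_pmull // muln_gt0 expn_gt0 r0.
have degV2 v : v \in V2 -> 2 * b <= nbr Y v by rewrite inE => /andP[].
have [KY [V3 [sKY cKY sV3 cV3 leV3]]] := many_common_kept b0 kY degV2 kY'.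
have hK1 : #|K1| <= q * t by apply: leq_trans ho; apply: subset_leq_card.
have nV3 v : v \in V3 -> nadj K1 v <= 85 * b.
  move=> vV3; apply: leq_trans (_ : nadj (union (others i)) v <= _); first exact: nadj_sub.
  by apply: class_misses_others; have := subsetP sV3 _ vV3; rewrite inE => /andP[].
have [K2 [V4 [sK2 sV4 cV4 ltV4 leV4]]] := many_common_removed t0 q0 hK1 nV3.
have bV4 : b <= #|V4|.
  have p0 : 0 < 4 * r ^ 3 * ((85 * b).+1 * q ^ (86 * b)).
    rewrite muln_gt0; apply/andP; split; last by rewrite muln_gt0 q_pos.
    by rewrite muln_gt0 expn_gt0 r0.
  rewrite -(leq_pmul2r p0).
  have up : n <= #|V4| * (4 * r ^ 3 * ((85 * b).+1 * q ^ (86 * b))).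
    apply: leq_trans leV2 _.
    apply: (@leq_trans (4 * r ^ 3 * (#|V4| * ((85 * b).+1 * q ^ (85 * b)) * q ^ b))).
      rewrite leq_mul2l; apply/orP; right; apply: leq_trans leV3 _.
      by rewrite leq_mul2r leV4 orbT.
    rewrite (_ : 86 * b = 85 * b + b) ?expnD; last by clear; lia.
    by apply: eq_leq; move: (r ^ 3) (q ^ (85 * b)) (q ^ b) (85 * b).+1 #|V4|; clear; lia.
  apply: leq_trans up; apply: leq_trans n_large.
  have e1 : q ^ (86 * b) <= q ^ (400 * b) by rewrite leq_pexp2l // leq_mul2r orbT.
  have e2 : (85 * b).+1 <= (400 * b).+1 by rewrite ltnS leq_mul2r orbT.
  have e3 : 4 * r ^ 3 <= 100 * 100 * r ^ 6 by apply: leq_mul => //; rewrite leq_pexp2l.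
  rewrite mulnCA /N; apply: leq_mul => //; apply: leq_mul; first by rewrite leq_pmull.
  exact: leq_mul.
have [V5 sV5 cV5] := subset_of_card bV4.
have [v4 v4P] : exists v, v \in V4 by apply/card_gt0P; apply: leq_trans bV4.
have [v1 v1P] : exists v, v \in V1 by apply/card_gt0P; apply: leq_trans Y0.
have lost1 : #|union (others i) :\: K1| <= 86 * b.
  rewrite -(nbrD _ v1); have := ltV1 _ v1P; have := nH _ (subsetP sV1 _ v1P).
  have := nadj_sub v1 (subsetDl (union (others i)) K1); move: le_tb; clear; lia.
have lost2 : #|K1 :\: K2| <= 86 * b.
  rewrite -(nbrD _ v4); have := ltV4 _ v4P; have := nV3 _ (subsetP sV4 _ v4P).
  have := nadj_sub v4 (subsetDl K1 K2); move: le_tb; clear; lia.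
apply: free; apply: (@contains_blowup (V5 :: KY :: [seq P :&: K2 | P <- others i])).
- have c1 : complete KY K2.
    by apply: completeS cV1 => //; apply: subset_trans sY.
  have c2 : complete V5 K2 by apply: completeS cV4.
  have c3 : complete V5 KY by apply: completeS cV3 => //; apply: subset_trans sV4.
  have := multipartite_attach c1 (multipartite_others i).
  rewrite {2}/multipartite /= => ->; rewrite andbT c3 /=.
  by apply: all_complete_sub c2; rewrite union_restrict subsetIr.
- rewrite /= size_map size_map size_filter ltnS.
  have := count_predC (pred1 i) (enum 'I_r).
  rewrite count_uniq_mem ?enum_uniq // mem_enum size_enum_ord /= => E.
  by rewrite -[X in X <= _]E.
rewrite /= cV5 cKY !leqnn all_map /=; apply/allP => P Po /=.
have [_ lowP _] := partL (othersP Po).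
have : #|P :\: K2| <= #|union (others i) :\: K1| + #|K1 :\: K2|.
  apply: leq_trans (leq_card_setU _ _); apply: subset_leq_card; apply/subsetP => u.
  rewrite !inE => /andP[-> uP]; rewrite (subsetP (sub_union Po) _ uP) andbT.
  by case: (u \in K1).
have := cardsID K2 P; move: lost1 lost2 lowP; rewrite /B; clear; lia.
Qed.

(** Removing the heavy vertices leaves nearly independent classes.
    The vertices in no class are those missing too much, the extending and the
    heavy ones; together they are at most a proportion 1 / (25 r). *)
Lemma blowup_of_classes (R : realType) : contains_copy (complete_blowup r.+1 b) G.
Proof.
pose D i := cls i :\: heavy i.
have light i u : u \in D i -> 2 * r ^ 3 * nbr (D i) u <= n.
  rewrite in_setD [_ \in heavy _]inE negb_and => /andP[/orP[/negP//|]].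
  rewrite -ltnNge => /ltnW le _; apply: leq_trans le.
  by rewrite leq_mul2l nbr_sub ?orbT // subsetDl.
have disjD i j : i != j -> [disjoint D i & D j].
  move=> neq; apply: disjointWl (subsetDl _ _) _; apply: disjointWr (subsetDl _ _) _.
  exact: class_disjoint.
have outD i u : u \in D i -> r * nadj (~: D i) u + r * #|D i| <= n.
  move=> uD; have p0 : 0 < 2 * r ^ 2 by rewrite muln_gt0 expn_gt0 r0.
  rewrite -(leq_pmul2l p0) -(leq_add2r n).
  have d : [disjoint D i & ~: D i] by rewrite disjoints_subset setCK.
  have := missT u; rewrite -(setUCr (D i)) nadjU //.
  have := light i u uD; rewrite -(nbrD (D i) u) (expnSr r 2).
  by move: (r ^ 2) (nbr _ _) (nadj (D i) u) (nadj (~: D i) u) (n); clear; nia.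
have leD i : r * #|D i| <= n.
  case: (posnP #|D i|) => [->|/card_gt0P[u uD]]; first by rewrite muln0.
  exact: leq_trans (leq_addl _ _) (outD i u uD).
have covD : 25 * (r * n) <= 25 * (r * \sum_i #|D i|) + n.
  pose X := [set v | 400 * b < nadj S v].
  pose E := [set v in V | [forall i, 2 * b <= nbr (part i) v]].
  have cov : [set: T] \subset X :|: E :|: \bigcup_i heavy i :|: \bigcup_i D i.
    apply/subsetP => v _; rewrite !in_setU.
    have [vX|] := boolP (v \in X); first by [].
    rewrite inE -leqNgt => vV; have [vE|] := boolP (v \in E); first by [].
    rewrite !inE vV negb_forall => /existsP[i]; rewrite -ltnNge => lti.
    have vC : v \in cls i by rewrite !inE vV.
    have [vH|nH] := boolP (v \in heavy i).
      by apply/orP; left; apply/bigcupP; exists i.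
    by apply/orP; right; apply/bigcupP; exists i; rewrite // in_setD nH.
  have le1 : n <= #|X| + N + r * N + \sum_i #|D i|.
    rewrite /n -cardsT; apply: leq_trans (subset_leq_card cov) _.
    apply: leq_trans (leq_card_setU _ _) _; apply: leq_add (leq_card_bigcup _).
    apply: leq_trans (leq_card_setU _ _) _; apply: leq_add.
      apply: leq_trans (leq_card_setU _ _) _; rewrite leq_add2l.
      exact/ltnW/few_extending.
    apply: leq_trans (leq_card_bigcup _) _.
    apply: (@leq_trans (\sum_(i < r) N)); first by apply: leq_sum => i _; apply/ltnW/few_heavy.
    by rewrite sum_nat_const card_ord.
  have hr2 : 400 * (r * (N + r * N)) <= n.
    apply: leq_trans n_large2; have : 2 * (r * N) <= r * (r * N) by rewrite leq_mul2r hr orbT.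
    by clear; lia.
  have := leq_mul (leqnn (25 * r)) le1; move: fewL hr2; rewrite -/X.
  by move: #|X| (\sum_i _) N n; clear; nia.
exact: (@blowup_of_near_turan R r t D hr t0 disjD leD covD outD missT n_large).
Qed.

End Classes.
End NearExtremal.

(** The field R carries the weights of the embedding. *)
Theorem blowup_of_large_degree (R : realType) (r t : nat) : 2 <= r -> 0 < t ->
  (forall v, 2 * r ^ 3 * nadj setT v + #|T| <= 2 * r ^ 2 * #|T|) ->
  100 * 100 * r ^ 6 * (320 * (r * t) * ((400 * (r * t)).+1 * (r ^ 11) ^ (400 * (r * t)))) <= #|T| ->
  contains_copy (complete_blowup r.+1 (r * t)) G.
Proof.
move=> hr t0 missT n_large; apply: boolp.contrapT => free.
have [L [S [mpL sizeL partL fewL]]] := free_structure hr t0 missT n_large free.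
exact/free/(blowup_of_classes hr t0 missT n_large free mpL sizeL partL fewL R).
Qed.

Local Open Scope ring_scope.

(** * From the number of edges to degrees *)

(** Each edge is the image of two ordered pairs of adjacent vertices. *)
Lemma double_edges : (2 * #|edges G| <= \sum_(v in [set: T]) nbr setT v)%N.
Proof.
pose A := [set p : T * T | G p.1 p.2].
have -> : (\sum_(v in [set: T]) nbr setT v = #|A|)%N.
  rewrite -sum1_card (eq_bigr (fun v => \sum_(u in [set u in setT | G v u]) 1)%N); last first.
    by move=> v _; rewrite sum1_card.
  rewrite pair_big_dep /=; apply: eq_bigl => -[v u] /=.
  by rewrite !inE.
have -> : edges G = [set [set p.1; p.2] | p in A].
  by apply/setP => e; apply/imsetP/imsetP => -[p Ap ->]; exists p; move: Ap; rewrite ?inE.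
rewrite -[#|A|]sum1_card (partition_big_imset (fun p : T * T => [set p.1; p.2])) /=.
rewrite mulnC -sum_nat_const; apply: leq_sum => e /imsetP[[x y]]; rewrite inE /= => Gxy ->.
have neq : x != y by apply: contraTneq Gxy => ->; rewrite adj_irr.
rewrite sum1dep_card; apply: (@leq_trans #|[set (x, y); (y, x)]|).
  by rewrite cards2 xpair_eqE negb_and neq.
apply: subset_leq_card; apply/subsetP => p; rewrite !inE => /orP[]/eqP-> /=.
  by rewrite Gxy eqxx.
by rewrite adj_sym Gxy setUC eqxx.
Qed.

Lemma sum_nadj_of_edges (R : realType) (eps : R) :
  (1 - eps) * #|T|%:R ^+ 2 / 2 <= #|edges G|%:R ->
  (\sum_(v in [set: T]) nadj setT v)%:R <= eps * #|T|%:R ^+ 2.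
Proof.
move=> leE; have := double_edges; rewrite -(ler_nat R) natrM => le2.
have : (\sum_(v in [set: T]) nbr setT v + \sum_(v in [set: T]) nadj setT v = #|T| * #|T|)%N.
  rewrite -big_split /= (eq_bigr (fun=> #|T|)).
    by rewrite sum_nat_const cardsT.
  by move=> v _; rewrite nbrD cardsT.
move/(congr1 (fun m : nat => m%:R : R)); rewrite natrD natrM -expr2.
by move: leE le2; lra.
Qed.

(** The subset maximizes eps' |U|^2 minus the number of ordered
    pairs of non-adjacent vertices of U.  Removing a vertex does not increase
    this quantity, which bounds the number of non-neighbours of the vertex; and
    U is large because the quantity is positive for the whole vertex set. *)
Lemma exists_dense_subset (R : realType) (eps eps' : R) : 0 <= eps ->
  (\sum_(v in [set: T]) nadj setT v)%:R <= eps * #|T|%:R ^+ 2 ->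
  exists U : {set T}, (eps' - eps) * #|T|%:R ^+ 2 <= eps' * #|U|%:R ^+ 2 /\
    forall v, v \in U -> 2 * (nadj U v)%:R <= eps' * (2 * #|U|%:R - 1) + 1.
Proof.
move=> eps0 leT.
pose g (U : {set T}) : R := eps' * #|U|%:R ^+ 2 - (\sum_(v in U) nadj U v)%:R.
have [U _ maxU] := @Order.TotalTheory.arg_maxP _ _ {set T} setT xpredT g isT.
have leg (V : {set T}) : g V <= g U by apply: maxU.
exists U; split.
  have := leg setT; rewrite /g cardsT.
  by have := ler0n R (\sum_(v in U) nadj U v); move: leT; lra.
move=> v vU; have := leg (U :\ v); rewrite /g.
have cU : (#|U| = #|U :\ v| + 1)%N by rewrite (cardsD1 v) vU addnC.
have E x : x \in U -> nadj U x = (~~ G x v + nadj (U :\ v) x)%N.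
  move=> xU; rewrite /nadj (cardsD1 v) inE vU; congr (_ + _)%N.
  by apply: eq_card => u; rewrite !inE andbA.
have sumE : (\sum_(x in U) nadj U x + 1 = \sum_(x in U :\ v) nadj (U :\ v) x + 2 * nadj U v)%N.
  rewrite (big_setD1 v) //= (eq_bigr (fun x => ~~ G x v + nadj (U :\ v) x)%N); last first.
    by move=> x; rewrite !inE => /andP[_]; apply: E.
  rewrite big_split /= (E v vU) adj_irr.
  have -> : (\sum_(i in U :\ v) ~~ G i v = nadj (U :\ v) v)%N.
    rewrite /nadj -sum1dep_card big_mkcondr /=.
    by apply: eq_bigr => x _; rewrite adj_sym; case: (G v x).
  by move: (\sum_(_ in _) _)%N (nadj _ _); clear; lia.
move/(congr1 (fun m : nat => m%:R : R)): sumE; rewrite [LHS]natrD [RHS]natrD [(2 * _)%:R]natrM cU natrD.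
by lra.
Qed.

End Graph.

Section Induced.
Variables (T : finType) (G : simple_graph T) (U : {set T}).
Let UT := {x : T | x \in U}.

Definition induced_adj : rel UT := fun x y => G (val x) (val y).
Lemma induced_sym : symmetric induced_adj.
Proof. by move=> x y; apply: adj_sym. Qed.
Lemma induced_irr : irreflexive induced_adj.
Proof. by move=> x; apply: adj_irr. Qed.
Definition induced : simple_graph UT := SimpleGraph induced_sym induced_irr.

Lemma card_induced : #|{: UT}| = #|U|.
Proof. by rewrite card_sig. Qed.

Lemma nadj_induced v : nadj induced setT v = nadj G U (val v).
Proof.
rewrite /nadj -(card_imset _ val_inj); apply: eq_card => u.
apply/imsetP/idP => [[x]|]; rewrite !inE.
  by move=> nx ->; rewrite (valP x).
by case/andP => uU nu; exists (Sub u uU) => //; rewrite !inE.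
Qed.

Lemma contains_induced (S : finType) (H : simple_graph S) :
  contains_copy H induced -> contains_copy H G.
Proof.
by case=> f injf homf; exists (val \o f) => [x y /= /val_inj/injf //|x y /homf].
Qed.

End Induced.

(** The relative loss 1 / (100 r^2) is small compared with the
    relative gap 1 / r^2 between eps and 1 / r. *)
Lemma dense_subset_of_edges (R : realType) (T : finType) (G : simple_graph T)
    (r : nat) (eps : R) : (2 <= r)%N -> 0 < eps ->
  (1 - r%:R^-1 + (r%:R^-1 - eps)) * #|T|%:R ^+ 2 / 2 <= #|edges G|%:R ->
  exists U : {set T}, (#|T| <= 200 * r ^ 2 * #|U|)%N /\
    forall v, v \in U -> 2 * (nadj G U v)%:R
      <= eps * (1 + 1 / (100 * r%:R ^+ 2)) * (2 * #|U|%:R - 1) + 1.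
Proof.
move=> hr eps0 leE.
have {}leE : (1 - eps) * #|T|%:R ^+ 2 / 2 <= #|edges G|%:R.
  by apply: le_trans leE; rewrite le_eqVlt; apply/orP; left; apply/eqP; congr (_ * _ / _); ring.
have leT := sum_nadj_of_edges leE.
have r2 : (2 <= r%:R :> R) by rewrite ler_nat.
set c := 1 / (100 * r%:R ^+ 2).
have rr : 4 <= r%:R ^+ 2 :> R by move: r2; clear; nra.
have c0 : 0 < c by rewrite divr_gt0 // mulr_gt0 //; move: rr; clear; lra.
have cE : c * (100 * r%:R ^+ 2) = 1 by rewrite /c divfK // gt_eqF // mulr_gt0 //; move: rr; clear; lra.
have [U [leU nU]] := exists_dense_subset (eps * (1 + c)) (ltW eps0) leT.
exists U; split=> //.
rewrite -(ler_nat R) natrM [(200 * _)%:R]natrM natrX.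
have h : #|T|%:R ^+ 2 <= (200 * r%:R ^+ 2 * #|U|%:R) ^+ 2 :> R.
  have h1 : c * #|T|%:R ^+ 2 <= (1 + c) * #|U|%:R ^+ 2.
    by rewrite -(ler_pM2l eps0); move: leU; clear; lra.
  have h2 : #|T|%:R ^+ 2 <= (100 * r%:R ^+ 2 + 1) * #|U|%:R ^+ 2 :> R.
    rewrite -(ler_pM2l c0); apply: le_trans h1 _.
    rewrite (_ : c * _ = (c * (100 * r%:R ^+ 2) + c) * #|U|%:R ^+ 2); last by ring.
    by rewrite cE.
  apply: le_trans h2 _; rewrite exprMn ler_wpM2r ?exprn_ge0 ?ler0n //.
  by move: rr; move: (r%:R ^+ 2) => w; nra.
by move: h; rewrite ler_pXn2r // nnegrE ?mulr_ge0 ?exprn_ge0 ?ler0n.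
Qed.

(** * Asymptotics *)

(** The deletions reduce the number of candidates by factors of
    up to n^(9 / 10), times a constant and a power of ln n, with L = ln n. *)
Lemma polynomial_budget (R : realType) (K A D : R) : 0 <= K -> 0 <= A ->
  exists2 L0, 0 <= L0 & forall L E, L0 <= L -> E <= 9 / 10 * L + D ->
    K * (A * L + 1) ^+ 2 * expR E <= expR L.
Proof.
move=> K0 A0; pose K' := K * expR D.
have K'0 : 0 <= K' by rewrite mulr_ge0 // expR_ge0.
have p0 : 0 <= 6000 * (K' * (A + 1) ^+ 2) by rewrite mulr_ge0 // mulr_ge0 // exprn_ge0 // addr_ge0.
exists (1 + 6000 * (K' * (A + 1) ^+ 2)); first by rewrite addr_ge0.
move=> L E leL leE.
have L1 : 1 <= L by apply: le_trans leL; rewrite lerDl.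
have L0 : 0 <= L by move: L1; clear; lra.
have e1 : expR E <= expR (9 / 10 * L) * expR D by rewrite -expRD ler_expR.
have e2 : expR L = expR (9 / 10 * L) * expR (L / 10).
  by rewrite -expRD; congr expR; field.
have e3 : K' * (A * L + 1) ^+ 2 <= expR (L / 10).
  have h : (L / 10) ^+ 3 / 6 <= expR (L / 10).
    apply: le_trans (@expR_ge1Dxn R (L / 10) 2 (divr_ge0 L0 (ler0n _ _))).
    by rewrite (_ : 3`! = 6)%N // lerDr.
  have h1 : (A * L + 1) ^+ 2 <= (A + 1) ^+ 2 * L ^+ 2.
    rewrite -exprMn ler_pXn2r ?nnegrE ?addr_ge0 ?mulr_ge0 ?addr_ge0 //.
    by rewrite mulrDl mul1r lerD2l.
  have h2 : K' * (A + 1) ^+ 2 * L ^+ 2 <= L / 6000 * L ^+ 2.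
    by rewrite ler_wpM2r ?exprn_ge0 //; move: leL; clear; lra.
  apply: (@le_trans _ _ (K' * (A + 1) ^+ 2 * L ^+ 2)).
    by rewrite -mulrA ler_wpM2l.
  apply: le_trans h2 (le_trans _ h).
  by rewrite le_eqVlt; apply/orP; left; apply/eqP; field.
apply: (@le_trans _ _ (K * (A * L + 1) ^+ 2 * (expR (9 / 10 * L) * expR D))).
  by rewrite ler_wpM2l // mulr_ge0 // exprn_ge0 // addr_ge0 // mulr_ge0.
rewrite e2 (_ : _ * (_ * expR D) = expR (9 / 10 * L) * (K' * (A * L + 1) ^+ 2)).
  by rewrite ler_wpM2l // expR_ge0.
by rewrite /K'; ring.
Qed.

Lemma natr_exp_expR (R : realType) (r k : nat) : (0 < r)%N ->
  (r ^ k)%:R = expR (k%:R * ln r%:R) :> R.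
Proof. by move=> r0; rewrite natrX expRM_natl lnK // posrE ltr0n. Qed.

(** Here q = r^11 and at most 400 b vertices are missed, so the
    losses are of order exp (4400 b ln r), and b is about
    ln n / (6000 eps r ln r) with eps r >= 9 / 10; note 4400 / 5400 < 9 / 10. *)
Lemma forces_near_extremal (R : realType) (r : nat) (eps : R) : (2 <= r)%N ->
  0 < eps -> eps <= r%:R^-1 - (r%:R ^+ 3)^-1 -> 9 / 10 <= eps * r%:R ->
  exists2 L0 : R, 0 <= L0 & forall n t, (0 < n)%N -> (0 < t)%N -> L0 <= ln n%:R ->
    t%:R <= 1 / (6000 * eps * r%:R ^+ 2 * ln r%:R) * ln n%:R + 1 ->
    forces_blowup n r (r%:R^-1 - eps) (r * t).
Proof.
move=> hr eps0 epsle epsge.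
have r0 : (0 < r)%N by apply: leq_trans hr.
have r2 : 2 <= r%:R :> R by rewrite ler_nat.
have lr0 : 0 < ln r%:R :> R by rewrite ln_gt0 // ltr1n.
set lr : R := ln r%:R in lr0 *.
have d0 : 0 < 6000 * eps * r%:R ^+ 2 * lr.
  by rewrite mulr_gt0 // mulr_gt0 ?exprn_gt0 ?mulr_gt0 // ltr0n.
pose A := 1 / (6000 * eps * r%:R ^+ 2 * lr).
have A0 : 0 <= A by rewrite divr_ge0 // ltW.
have AE : A * (6000 * eps * r%:R ^+ 2 * lr) = 1 by rewrite divfK // gt_eqF.
pose C := (200 * r ^ 2 * (100 * 100 * r ^ 6 * (320 * r * (401 * r))))%N.
pose D : R := 4400 * r%:R * lr.
have [L0 L00 budget] := polynomial_budget D (ler0n R C) A0.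
exists L0 => // n t n0 t0 leL let_ T G cT leE.
have L_ge0 : 0 <= ln n%:R :> R by rewrite ln_ge0 // ler1n.
have [U [cU nU]] : exists U : {set T}, (#|T| <= 200 * r ^ 2 * #|U|)%N /\
    forall v, v \in U -> 2 * (nadj G U v)%:R
      <= eps * (1 + 1 / (100 * r%:R ^+ 2)) * (2 * #|U|%:R - 1) + 1.
  by apply: dense_subset_of_edges => //; rewrite cT.
pose Q := ((r ^ 11) ^ (400 * (r * t)))%N.
have Q0 : (0 < Q)%N by rewrite !expn_gt0 r0.
have large : (100 * 100 * r ^ 6 * (320 * (r * t) * ((400 * (r * t)).+1 * Q)) <= #|U|)%N.
  have p0 : (0 < 200 * r ^ 2)%N by rewrite muln_gt0 expn_gt0 r0.
  rewrite -(leq_pmul2l p0); apply: leq_trans cU; rewrite cT.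
  apply: (@leq_trans (C * (t * t) * Q)).
    have h : ((400 * (r * t)).+1 <= 401 * (r * t))%N.
      by have : (0 < r * t)%N; [rewrite muln_gt0 r0 | clear; lia].
    apply: (@leq_trans (200 * r ^ 2 * (100 * 100 * r ^ 6 * (320 * (r * t) * (401 * (r * t) * Q))))).
      by rewrite !leq_mul2l leq_mul2r h !orbT.
    by rewrite /C; apply: eq_leq; move: (r ^ 2)%N (r ^ 6)%N (100 * 100)%N (Q); clear; lia.
  rewrite -(ler_nat R) natrM [(C * _)%:R]natrM natrM -expr2.
  have -> : Q%:R = expR ((4400 * r%:R * lr) * t%:R) :> R.
    rewrite /Q -expnM natr_exp_expR //; congr expR; rewrite -/lr !natrM; ring.
  have -> : n%:R = expR (ln n%:R) :> R by rewrite lnK // posrE ltr0n.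
  apply: le_trans (budget (ln n%:R) ((4400 * r%:R * lr) * t%:R) leL _).
    rewrite ler_wpM2r ?expR_ge0 // ler_wpM2l ?ler0n //.
    have AL := addr_ge0 (mulr_ge0 A0 L_ge0) ler01.
    by rewrite ler_pXn2r ?nnegrE.
  have w0 : 0 <= r%:R * lr by rewrite mulr_ge0 // ltW.
  have h1 := ler_wpM2l w0 let_.
  have h2 : r%:R * lr * A <= 1 / 5400.
    have wA0 : 0 <= r%:R * lr * A by rewrite mulr_ge0.
    by have := ler_wpM2r wA0 epsge; move: AE; clear; lra.
  have h3 := ler_wpM2r L_ge0 h2.
  by move: h1 h3 L_ge0; rewrite -/A /D; move: (ln n%:R) => x; clear; lra.
have m_ge : (2 * r ^ 3 <= #|U|)%N.
  apply: leq_trans large; rewrite -[X in (X <= _)%N]muln1; apply: leq_mul.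
    by apply: leq_mul => //; rewrite leq_pexp2l.
  by rewrite muln_gt0 muln_gt0 muln_gt0 r0 t0 muln_gt0 Q0.
apply: (@contains_induced _ _ U); apply: (@blowup_of_large_degree _ _ R) => //; last first.
  by rewrite card_induced.
move=> v; rewrite nadj_induced card_induced.
have := nU _ (valP v); set d := nadj G U _; set m := #|U| in m_ge *.
move: m_ge; rewrite -!(ler_nat R) natrD.
have -> : (2 * r ^ 3 * d)%:R = 2 * r%:R ^+ 3 * d%:R :> R by rewrite natrM [(2 * _)%:R]natrM natrX.
have -> : (2 * r ^ 2 * m)%:R = 2 * r%:R ^+ 2 * m%:R :> R by rewrite natrM [(2 * _)%:R]natrM natrX.
have -> : (2 * r ^ 3)%:R = 2 * r%:R ^+ 3 :> R by rewrite natrM natrX.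
set c := 1 / (100 * r%:R ^+ 2).
have rr : 4 <= r%:R ^+ 2 :> R by move: r2; clear; nra.
have r3 : 8 <= r%:R ^+ 3 :> R by rewrite exprS; move: r2 rr; clear; nra.
have c0 : 0 < c by rewrite divr_gt0 // mulr_gt0 //; move: rr; clear; lra.
have cE : c * r%:R ^+ 2 = 1 / 100.
  by rewrite /c; field; rewrite gt_eqF //; move: r2; clear; lra.
have epsr : eps * r%:R ^+ 3 <= r%:R ^+ 2 - 1.
  have p3 : 0 < r%:R ^+ 3 :> R by move: r3; clear; lra.
  have := ler_wpM2r (ltW p3) epsle; rewrite mulrBl mulVf ?gt_eqF //.
  by rewrite (_ : r%:R^-1 * r%:R ^+ 3 = r%:R ^+ 2) // exprS mulKf // gt_eqF // ltr0n.
move=> m_ge le_d.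
have P1 : eps * r%:R ^+ 3 * (1 + c) <= r%:R ^+ 2 - 99 / 100.
  apply: (@le_trans _ _ ((r%:R ^+ 2 - 1) * (1 + c))); last first.
    by move: cE c0; clear; lra.
  by rewrite ler_wpM2r //; move: c0; clear; lra.
have m1 : 0 <= 2 * m%:R - 1 :> R by move: m_ge r3; clear; lra.
have P2 := ler_wpM2r m1 P1.
have r3_0 : 0 <= r%:R ^+ 3 :> R by move: r3; clear; lra.
have P3 := ler_wpM2l r3_0 le_d.
move: P2 P3 m_ge rr m1; move: (r%:R ^+ 3) (r%:R ^+ 2) d%:R m%:R => u w x z; clear; lra.
Qed.

(** Here q = r^7 and y is about 21 / 20 eps r B, so that the
    losses are of order exp (2368 eps r b ln r), whatever the size of eps. *)
Lemma forces_sparse_complement (R : realType) (r : nat) (eps : R) : (2 <= r)%N ->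
  0 < eps -> eps * r%:R <= 9 / 10 ->
  exists2 L0 : R, 0 <= L0 & forall n t, (0 < n)%N -> (0 < t)%N -> L0 <= ln n%:R ->
    t%:R <= 1 / (6000 * eps * r%:R ^+ 2 * ln r%:R) * ln n%:R + 1 ->
    forces_blowup n r (r%:R^-1 - eps) (r * t).
Proof.
move=> hr eps0 epsle.
have r0 : (0 < r)%N by apply: leq_trans hr.
have r2 : 2 <= r%:R :> R by rewrite ler_nat.
have rr : 4 <= r%:R ^+ 2 :> R by move: r2; clear; nra.
have lr0 : 0 < ln r%:R :> R by rewrite ln_gt0 // ltr1n.
set lr : R := ln r%:R in lr0 *.
have d0 : 0 < 6000 * eps * r%:R ^+ 2 * lr.
  by rewrite mulr_gt0 // mulr_gt0 ?exprn_gt0 ?mulr_gt0 // ltr0n.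
pose A := 1 / (6000 * eps * r%:R ^+ 2 * lr).
have A0 : 0 <= A by rewrite divr_ge0 // ltW.
have AE : A * (6000 * eps * r%:R ^+ 2 * lr) = 1 by rewrite divfK // gt_eqF.
pose C := (200 * r ^ 2 * (21 * (320 * r * (320 * r))))%N.
pose D : R := 2368 * (eps * r%:R ^+ 2 * lr).
have [L0 L00 budget] := polynomial_budget D (ler0n R C) A0.
pose L1 : R := 100 * 100 * (r%:R ^+ 2 * r%:R ^+ 2) / eps.
have L10 : 0 <= L1.
  by rewrite divr_ge0 ?(ltW eps0) // mulr_ge0 // mulr_ge0 // exprn_ge0.
exists (L0 + L1); first exact: addr_ge0.
move=> n t n0 t0 leL let_ T G cT leE.
have L_ge0 : 0 <= ln n%:R :> R by rewrite ln_ge0 // ler1n.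
have leL0 : L0 <= ln n%:R by move: leL L10; clear; lra.
have leL1 : L1 <= n%:R.
  have nR : 0 < n%:R :> R by rewrite ltr0n.
  by have := ln_sublinear nR; move: leL L00; clear; lra.
have [U [cU nU]] : exists U : {set T}, (#|T| <= 200 * r ^ 2 * #|U|)%N /\
    forall v, v \in U -> 2 * (nadj G U v)%:R
      <= eps * (1 + 1 / (100 * r%:R ^+ 2)) * (2 * #|U|%:R - 1) + 1.
  by apply: dense_subset_of_edges => //; rewrite cT.
set c := 1 / (100 * r%:R ^+ 2) in nU.
have c0 : 0 < c by rewrite divr_gt0 // mulr_gt0 //; move: rr; clear; lra.
have cE : c * r%:R ^+ 2 = 1 / 100.
  by rewrite /c; field; rewrite gt_eqF //; move: r2; clear; lra.
have cle : c <= 1 / 400.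
  by have := ler_wpM2l (ltW c0) rr; rewrite cE; clear; lra.
pose e1 := eps * (1 + 2 * c).
have e1_le : e1 <= 201 / 200 * eps by rewrite /e1; have := ler_wpM2l (ltW eps0) cle; clear; lra.
have e1_0 : 0 < e1 by rewrite mulr_gt0 //; move: c0; clear; lra.
have e1r : e1 * r%:R <= 1809 / 2000.
  have r_0 : 0 <= r%:R :> R by exact: ler0n.
  by have := ler_wpM2r r_0 e1_le; move: epsle; clear; lra.
pose b := (r * t)%N.
have b0 : (0 < b)%N by rewrite muln_gt0 r0.
pose B := (320 * b)%N.
pose Mx := (r * B + b)%N.
have MxE : Mx%:R = 320 * (r%:R * b%:R) + b%:R :> R.
  by rewrite /Mx /B natrD natrM [(320 * b)%:R]natrM; ring.
have bR : 0 < b%:R :> R by rewrite ltr0n.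
pose z : R := 21 / 20 * (e1 * Mx%:R).
pose y := Num.truncn z.
have z0 : 0 <= z.
  by apply: mulr_ge0; [rewrite divr_ge0 | apply: mulr_ge0; [exact: ltW | exact: ler0n]].
have yz : y%:R <= z by have /andP[] := truncn_itv z0.
(* 13461 / 40 = 21 / 20 * (320 + 1 / 2), where b <= 1 / 2 * r b *)
have zb : z <= 13461 / 40 * (e1 * (r%:R * b%:R)).
  rewrite /z MxE; have b2 := ler_wpM2r (ltW bR) r2.
  have := mulr_ge0 (ltW e1_0) (ltW bR).
  by have := ler_wpM2l (ltW e1_0) b2; clear; lra.
have ltB : (y + 10 * b < B)%N.
  rewrite -(ltr_nat R) natrD [(10 * b)%:R]natrM [B%:R]natrM.
  by have := ler_wpM2r (ltW bR) e1r; move: yz zb bR; clear; lra.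
have q0 : (0 < r ^ 7)%N by rewrite expn_gt0 r0.
pose N := (B * (y.+1 * (r ^ 7) ^ y))%N.
have large : (21 * N <= #|U|)%N.
  have p0 : (0 < 200 * r ^ 2)%N by rewrite muln_gt0 expn_gt0 r0.
  rewrite -(leq_pmul2l p0); apply: leq_trans cU; rewrite cT.
  apply: (@leq_trans (C * (t * t) * (r ^ 7) ^ y)).
    have h : (y.+1 <= B)%N by apply: leq_ltn_trans ltB; apply: leq_addr.
    apply: (@leq_trans (200 * r ^ 2 * (21 * (B * (B * (r ^ 7) ^ y))))).
      by rewrite !leq_mul2l leq_mul2r h !orbT.
    by rewrite /C /B /b; apply: eq_leq; move: (r ^ 2)%N ((r ^ 7) ^ y)%N; clear; lia.
  rewrite -(ler_nat R) natrM [(C * _)%:R]natrM natrM -expr2.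
  have -> : ((r ^ 7) ^ y)%:R = expR (7 * y%:R * lr) :> R.
    by rewrite -expnM natr_exp_expR //; congr expR; rewrite -/lr natrM.
  have -> : n%:R = expR (ln n%:R) :> R by rewrite lnK // posrE ltr0n.
  apply: le_trans (budget (ln n%:R) (7 * y%:R * lr) leL0 _).
    rewrite ler_wpM2r ?expR_ge0 // ler_wpM2l ?ler0n //.
    have AL := addr_ge0 (mulr_ge0 A0 L_ge0) ler01.
    by rewrite ler_pXn2r ?nnegrE.
  have rb0 : 0 <= r%:R * b%:R :> R by rewrite mulr_ge0.
  have h1 : y%:R <= 2368 / 7 * (eps * (r%:R * b%:R)).
    by have := ler_wpM2r rb0 e1_le; move: yz zb; have := mulr_ge0 (ltW eps0) rb0; clear; lra.
  have h2 := ler_wpM2r (ltW lr0) h1.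
  have w0 : 0 <= eps * r%:R ^+ 2 * lr by rewrite mulr_ge0 ?mulr_ge0 ?exprn_ge0 // ltW.
  have h3 := ler_wpM2l w0 let_.
  have h4 : eps * r%:R ^+ 2 * lr * (A * ln n%:R) = 1 / 6000 * ln n%:R.
    rewrite mulrA; congr (_ * _); move: AE; clear; lra.
  have bE : b%:R = r%:R * t%:R :> R by rewrite natrM.
  move: h2 h3 h4 L_ge0; rewrite -/A /D bE; move: (A) (ln n%:R) => a x; clear; lra.
apply: (@contains_induced _ _ U).
apply: (@blowup_of_few_missing _ (induced G U) R r b B y (10 * b) (r ^ 7) N e1) => //.
- by rewrite leq_mul2r orbT.
- by rewrite muln_gt0.
- have r6 : (64 <= r ^ 6)%N by apply: (@leq_trans (2 ^ 6)) => //; rewrite leq_exp2r.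
  rewrite /B (expnSr r 6); have := leq_mul r6 (leqnn (r * b)).
  have : (1 * b <= r * b)%N by rewrite leq_mul2r r0 orbT.
  by move: (r ^ 6)%N; clear; lia.
- by rewrite card_induced.
- move=> v; rewrite nadj_induced card_induced.
  have := nU _ (valP v); set d := nadj G U _; set m := #|U|.
  have h1 : n%:R <= 200 * r%:R ^+ 2 * m%:R :> R.
    by rewrite -natrX -!natrM ler_nat -cT.
  have h2 : 1 / 2 <= eps * c * m%:R.
    have h3 : L1 * eps = 100 * 100 * (r%:R ^+ 2 * r%:R ^+ 2) by rewrite divfK // gt_eqF.
    have h4 : 100 * 100 * (r%:R ^+ 2 * r%:R ^+ 2) <= 200 * r%:R ^+ 2 * m%:R * eps.
      by rewrite -h3 ler_wpM2r ?(ltW eps0) //; apply: le_trans leL1 h1.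
    have r20 : 0 < r%:R ^+ 2 :> R by move: rr; clear; lra.
    have h5 : 50 * r%:R ^+ 2 <= m%:R * eps.
      by rewrite -(ler_pM2l r20); move: h4; clear; lra.
    by have := ler_wpM2l (ltW c0) h5; move: cE; clear; lra.
  have c_e := mulr_ge0 (ltW c0) (ltW eps0).
  rewrite /e1; move: h2 c_e eps0; clear; lra.
- exact: ltW (truncnS_gt _).
Qed.

Definition distinct n : rel 'I_n := fun x y => x != y.

Lemma distinct_sym n : symmetric (@distinct n).
Proof. by move=> x y; rewrite /distinct eq_sym. Qed.

Lemma distinct_irr n : irreflexive (@distinct n).
Proof. by move=> x; rewrite /distinct eqxx. Qed.

Definition complete_graph n := SimpleGraph (@distinct_sym n) (@distinct_irr n).

Lemma card_edges_complete n : #|edges (complete_graph n)| = 'C(n, 2).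
Proof.
rewrite -[n in 'C(n, 2)]card_ord -card_draws; apply: eq_card => e; rewrite inE.
apply/imsetP/cards2P => [[[x y]]|[x [y [neq ->]]]].
  by rewrite inE /= => neq ->; exists x, y.
by exists (x, y); rewrite ?inE.
Qed.

(** For n >= 1 / eps the complete graph has enough edges, and the
    blow-up must fit into it. *)
Lemma forces_bounded (R : realType) (n r b : nat) (eps : R) : (2 <= r)%N ->
  (0 < n)%N -> 1 / n%:R <= eps -> forces_blowup n r (r%:R^-1 - eps) b -> (b <= n)%N.
Proof.
move=> hr n0 leeps forces.
have nR : 0 < n%:R :> R by rewrite ltr0n.
have leE : (1 - r%:R^-1 + (r%:R^-1 - eps)) * n%:R ^+ 2 / 2 <= #|edges (complete_graph n)|%:R.
  rewrite card_edges_complete.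
  have E : ('C(n, 2) * 2)%:R = n%:R * (n%:R - 1) :> R.
    rewrite bin2 muln2 halfK; have -> : odd (n * n.-1) = false.
      by case: (n) => // m; rewrite oddM /= andNb.
    by rewrite subn0 natrM -subn1 natrB.
  have h : 1 <= eps * n%:R by rewrite -ler_pdivrMr.
  have h2 := ler_wpM2r (ltW nR) h.
  by move: E h2; rewrite natrM; clear; lra.
have [f injf _] := forces _ (complete_graph n) (card_ord n) leE.
have := leq_card f injf; rewrite card_prod !card_ord; apply: leq_trans.
by rewrite leq_pmull.
Qed.

Theorem theorem1 (R : realType) (r : nat) (eps : R)
    (hr : (2 <= r)%N) (heps0 : 0 < eps)
    (heps1 : eps <= r%:R^-1 - (r%:R ^+ 3)^-1) :
  exists n0 : nat, forall n : nat, (n0 < n)%N ->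
    exists b : nat, is_bn n r (r%:R^-1 - eps) b /\
      ln n%:R / (6000 * eps * r%:R * ln r%:R) <= b%:R.
Proof.
have r0 : (0 < r)%N by apply: leq_trans hr.
have rR : 0 < r%:R :> R by rewrite ltr0n.
have lr0 : 0 < ln r%:R :> R by rewrite ln_gt0 // ltr1n.
have [L0 L00 forces] : exists2 L0 : R, 0 <= L0 &
   forall n t, (0 < n)%N -> (0 < t)%N -> L0 <= ln n%:R ->
    t%:R <= 1 / (6000 * eps * r%:R ^+ 2 * ln r%:R) * ln n%:R + 1 ->
    forces_blowup n r (r%:R^-1 - eps) (r * t).
  case: (leP (9 / 10) (eps * r%:R)) => [ge|/ltW le].
    exact: forces_near_extremal.
  exact: forces_sparse_complement.
exists (maxn (Num.truncn (expR L0)) (Num.truncn (1 / eps))) => n.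
rewrite gtn_max => /andP[nL ne].
have n0 : (0 < n)%N by apply: leq_ltn_trans nL.
have nR : 0 < n%:R :> R by rewrite ltr0n.
have leL : L0 <= ln n%:R.
  have h : expR L0 <= n%:R.
    by apply: le_trans (ltW (truncnS_gt (expR L0))) _; rewrite ler_nat.
  by rewrite -ler_expR lnK // posrE.
have leeps : 1 / n%:R <= eps.
  have h : 1 / eps <= n%:R.
    by apply: le_trans (ltW (truncnS_gt (1 / eps))) _; rewrite ler_nat.
  by rewrite ler_pdivrMr // mulrC -ler_pdivrMr.
have L_ge0 : 0 <= ln n%:R :> R by exact: le_trans L00 leL.
have x0 : 0 <= 1 / (6000 * eps * r%:R ^+ 2 * ln r%:R) * ln n%:R.
  by rewrite mulr_ge0 // divr_ge0 // !mulr_ge0 ?exprn_ge0 // ltW.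
pose t := (Num.truncn (1 / (6000 * eps * r%:R ^+ 2 * ln r%:R) * ln n%:R)).+1.
have force_t : forces_blowup n r (r%:R^-1 - eps) (r * t).
  apply: forces => //; rewrite /t -[(Num.truncn _).+1%:R]natr1 lerD2r.
  by have /andP[] := truncn_itv x0.
have [b [forces_b maxb]] : exists b, forces_blowup n r (r%:R^-1 - eps) b /\
    forall b', forces_blowup n r (r%:R^-1 - eps) b' -> (b' <= b)%N.
  apply: (@ex_max_nat _ n); first by exists (r * t)%N.
  by move=> b; apply: forces_bounded.
exists b; split=> //.
apply: (@le_trans _ _ (r * t)%:R); last by rewrite ler_nat; apply: maxb.
have tx := ltW (truncnS_gt (1 / (6000 * eps * r%:R ^+ 2 * ln r%:R) * ln n%:R)).
rewrite natrM; apply: le_trans (ler_wpM2l (ltW rR) tx).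
rewrite le_eqVlt; apply/orP; left; apply/eqP; field.
by rewrite !gt_eqF.
Qed.
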